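(* Let $X$ be a Banach space with $n(X)>1/2$. If $\mathcal{K}_v(X)$ is an M-ideal in $\mathcal{L}_v(X)$, then $X$ is Asplund. In particular, if $X$ is a Banach space containing an isomorphic copy of $\ell_1$ such that $n(X)>1/2$, then $\mathcal{K}_v(X)$ is not an M-ideal in $\mathcal{L}_v(X)$.
   Context: Banach spaces are over $\mathbb{K}=\mathbb{R}$ or $\mathbb{C}$; $S_X$ denotes the unit sphere of $X$. $\mathcal{L}(X)$ is the space of bounded linear operators on $X$ and $\mathcal{K}(X)$ its subspace of compact operators. Put $\Pi(X)=\{(x^*,x)\in S_{X^*}\times S_X: x^*(x)=1\}$. The numerical radius of $T\in\mathcal{L}(X)$ is $v(T)=\sup\{|x^*(Tx)|:(x^*,x)\in\Pi(X)\}$, and the numerical index of $X$ is $n(X)=\inf\{v(T):T\in\mathcal{L}(X),\ \|T\|=1\}$. If $n(X)>0$, then $v$ is a norm on $\mathcal{L}(X)$ equivalent to the operator norm; $\mathcal{L}_v(X)$ and $\mathcal{K}_v(X)$ denote $\mathcal{L}(X)$ and $\mathcal{K}(X)$ equipped with the norm $v$. A closed subspace $J$ of a Banach space $Z$ is an M-ideal in $Z$ if $Z^*=J^*\oplus_1 J^\perp$, i.e. the annihilator $J^\perp$ is the kernel of a linear projection $P$ on $Z^*$ with $\|z^*\|=\|Pz^*\|+\|z^*-Pz^*\|$ for all $z^*\in Z^*$ (the range of $P$ then being identified isometrically with $J^*$). A Banach space is Asplund if each of its separable subspaces has separable dual (equivalently, its dual has the Radon-Nikodým property). *)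

(* Defs.v *)
From HB Require Import structures.
From mathcomp Require Import all_boot all_order all_algebra.
From mathcomp Require Import all_classical all_reals all_analysis.
From mathcomp Require Export complex.

Set Implicit Arguments.
Unset Strict Implicit.
Unset Printing Implicit Defensive.

Import Order.TTheory GRing.Theory Num.Theory.
Import numFieldNormedType.Exports.

Local Open Scope classical_set_scope.
Local Open Scope ring_scope.

(* Scalars are a numFieldType K, instantiated to R or R[i] in the end. Norms   *)
(* take their values in K, where x <= y means that y - x is a nonnegative real *)
(* number; suprema and infima of sets of real numbers computed in R[i] are the *)
(* usual ones.                                                                 *)

(* Several norms live on the same vector space (operator norm and numerical    *)
(* radius on operators), so the norm N of the domain is an explicit function.  *)
Section BoundedOperators.
Variables (K : numFieldType) (E : lmodType K) (N : E -> K).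
Variable F : normedModType K.

Definition bounded_linear : {pred E -> F} :=
  fun f => `[< linear f /\ exists C : K, forall x, `|f x| <= C * N x >].

Lemma bounded_linear_submod : submod_closed bounded_linear.
Proof.
split=> [|a f g /asboolP[lf [C fC]] /asboolP[lg [D gD]]]; apply/asboolP.
  split=> [b x y|]; first by rewrite /= scaler0 addr0.
  by exists 0 => x; rewrite normr0 mul0r.
split=> [b x y|].
  rewrite !fctE lf lg !scalerDr !scalerA [a * b]mulrC addrACA.
  by congr (_ + _).
exists (`|a| * C + D) => x; rewrite !fctE (le_trans (ler_normD _ _))// mulrDl.
by rewrite lerD// normrZ -mulrA ler_wpM2l.
Qed.

HB.instance Definition _ :=
  GRing.isSubmodClosed.Build K (E -> F) bounded_linear bounded_linear_submod.

Record boundedOp := BoundedOp {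
  boundedOp_fun :> E -> F;
  boundedOpP : boundedOp_fun \in bounded_linear }.

HB.instance Definition _ := [isSub for boundedOp_fun].
HB.instance Definition _ := [Choice of boundedOp by <:].
HB.instance Definition _ := [SubChoice_isSubLmodule of boundedOp by <:].

Definition opnorm (f : boundedOp) : K :=
  supremum 0 [set `|f x| | x in [set x | N x <= 1]].

End BoundedOperators.
Arguments opnorm {K E N F} f.


Section NormedSpaces.
Variables (K : numFieldType) (Z : lmodType K) (N : Z -> K).

Definition separable_for : Prop :=
  exists2 D : set Z, countable D &
    forall (z : Z) (e : K), 0 < e -> exists2 d, D d & N (z - d) < e.

Definition closed_for (J : set Z) : Prop :=
  forall z : Z,
    (forall e : K, 0 < e -> exists2 y, J y & N (z - y) < e) -> J z.

Definition linear_subspace (J : set Z) : Prop :=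
  J 0 /\ forall (a : K) (u v : Z), J u -> J v -> J (a *: u + v).

Definition annihilator (J : set Z) : set (boundedOp N K^o) :=
  [set f | forall z, J z -> f z = 0].

Definition M_ideal (J : set Z) : Prop :=
  [/\ linear_subspace J, closed_for J &
      exists P : {linear boundedOp N K^o -> boundedOp N K^o},
        [/\ forall f, P (P f) = P f,
            [set f | P f = 0] = annihilator J &
            forall f, opnorm f = opnorm (P f) + opnorm (f - P f)]].

End NormedSpaces.

Section BanachSpaces.
Variables (K : numFieldType) (X : normedModType K).

Definition dual := boundedOp (@Num.norm K X) K^o.
Definition operators := boundedOp (@Num.norm K X) X.

HB.instance Definition _ := GRing.Lmodule.on dual.
HB.instance Definition _ := GRing.Lmodule.on operators.

Definition compact_operators : set operators :=
  [set T | precompact (T @` [set x | `|x| <= 1])].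

Definition norming_pairs : set (dual * X) :=
  [set p : dual * X | [/\ opnorm p.1 = 1, `|p.2| = 1 & p.1 p.2 = 1]].

Definition numerical_radius (T : operators) : K :=
  supremum 0 [set `|p.1 (T p.2)| | p in norming_pairs].

(* The numerical index lies in [0, 1], where the infimum of the empty set is  *)
(* 1: this is the value for the zero space.                                   *)
Definition numerical_index : K :=
  infimum 1 [set numerical_radius T | T in [set T : operators | opnorm T = 1]].

Definition subspace (S : submodClosed X) := {x : X | x \in S}.

HB.instance Definition _ (S : submodClosed X) := SubChoice.on (subspace S).
HB.instance Definition _ (S : submodClosed X) :=
  [SubChoice_isSubLmodule of subspace S by <:].

Definition subspace_norm (S : submodClosed X) (y : subspace S) : K :=
  `|val y|.

Definition asplund : Prop := forall S : submodClosed X,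
  separable_for (@subspace_norm S) ->
  separable_for (@opnorm K (subspace S) (@subspace_norm S) K^o).

End BanachSpaces.

Section Ell1.
Variable K : numFieldType.

Definition summable_seq : {pred nat -> K^o} :=
  fun a => `[< exists M : K, forall n, \sum_(k < n) `|a k| <= M >].

Lemma summable_seq_submod : submod_closed summable_seq.
Proof.
split=> [|c a b /asboolP[M aM] /asboolP[L bL]]; apply/asboolP.
  by exists 0 => n; rewrite big1// => k _; rewrite normr0.
exists (`|c| * M + L) => n.
apply: (@le_trans _ _ (\sum_(k < n) (`|c| * `|a k| + `|b k|))).
  by apply: ler_sum => k _; rewrite -normrM; exact: ler_normD.
rewrite big_split/= -mulr_sumr; apply: lerD; last exact: bL.
by apply: ler_wpM2l; [exact: normr_ge0|exact: aM].
Qed.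

HB.instance Definition _ := GRing.isSubmodClosed.Build K (nat -> K^o)
  summable_seq summable_seq_submod.

Record ell1 := Ell1 { ell1_seq :> nat -> K^o; ell1P : ell1_seq \in summable_seq }.

HB.instance Definition _ := [isSub for ell1_seq].
HB.instance Definition _ := [Choice of ell1 by <:].
HB.instance Definition _ := [SubChoice_isSubLmodule of ell1 by <:].

Definition ell1_norm (a : ell1) : K :=
  limn (series (fun k => `|a k| : K^o)).

Definition contains_ell1 (X : normedModType K) : Prop :=
  exists (J : {linear ell1 -> X}) (c C : K),
    0 < c /\ forall a : ell1, c * ell1_norm a <= `|J a| <= C * ell1_norm a.

End Ell1.

(* Main.v *)
From HB Require Import structures.
Require Import Defs.
From mathcomp Require Import all_boot all_order all_algebra.
From mathcomp Require Import all_classical all_reals all_analysis.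
From mathcomp Require Import complex.
From mathcomp Require Import ring lra.
Import Order.TTheory GRing.Theory Num.Theory.
Import numFieldNormedType.Exports.
Local Open Scope classical_set_scope.
Local Open Scope ring_scope.

Set Implicit Arguments.
Unset Strict Implicit.
Unset Printing Implicit Defensive.

(** Let n > 1/2 be the numerical index, so that n ||T|| <= v(T) <= ||T|| for
    every operator T, and write L_v for the space of operators normed by v.
    Suppose that X has a separable subspace Y whose dual is not separable.

    The failure of separability yields, for every small t > 0, a functional f
    of norm at most 1 and points y_m of the unit ball of Y such that f(y_m) is
    at least 1 - t^2, while the y_m are asymptotically orthogonal to Y: for d
    in Y and a scalar k, |d + k y_m| is asymptotically at least |d|
    (almost_norming_sequence). Indeed, take norming functionals v_k for a dense
    sequence of Y; their span is not dense in the dual of Y, so some functional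
    stays large on every finite intersection of the kernels of the v_k, and the
    y_m are taken there.

    Let U be a nonprincipal ultrafilter on the natural numbers. On pairs (x, T)
    made of a vector and an operator, p(x, T) = lim_U |x + T y_m| is a seminorm,
    and orthogonality says that (d, k I) |-> f(d) is dominated by p on the pairs
    with d in Y. A Hahn-Banach extension phi of it gives a functional x0 =
    phi(., 0) of norm at most 1 which agrees with f on Y, and two functionals on
    operators,

      psi(T) = phi(0, T)  and  psi0(T) = lim_U x0(T y_m).

    They agree on compact operators, for which T y_m has a limit along U; but
    psi(I) = 0 while psi0(I) >= 1 - t^2 (separating_functionals). The norm of psi
    in L_v^* is at most 1/n because |psi(T)| <= ||T||. The norm of psi0 is almost
    1: the pairs (x0, y_m) almost lie in Pi(X), so that |x0(T y_m)| is at most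
    v(T) up to a factor 1 + 12 t (almost_norming_pair); and psi0 almost attains 1
    at a rank one operator of radius at most 1.

    Let P be the projection of the M-ideal. As psi0 almost attains its norm on
    compact operators, psi0 - P psi0 is small; as psi - psi0 kills the compact
    operators, P psi = P psi0. Hence

      1/n >= ||psi|| = ||P psi0|| + ||psi - P psi0||,

    where the first term is close to 1, and so is the second one, since its value
    at I is - P psi0 (I). Thus 1/n >= 2 up to O(t), which contradicts n > 1/2
    (M_ideal_asplund).

    A space containing l_1 is not Asplund: the copy of l_1 is separable, and the
    functionals a |-> sum of the a_k with k in A, one for each set A of
    indices, are uniformly separated (contains_ell1_not_asplund).

    Real and complex scalars are treated together, through the maps and the
    identities collected in the record scalars. *)

(** * Real and complex scalars *)

(** What the proof uses about K = R or K = R[i]: the embedding of R, the real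
    part, and the element iu, which is 0 in the real case and the imaginary unit
    in the complex case. With this choice of iu the field scalar_split recovers
    a scalar from real parts in both cases. *)
Record scalars (R : realType) (K : numFieldType) := Scalars {
  emb : {rmorphism R -> K};
  re : {additive K -> R};
  iu : K;
  embK : cancel emb re;
  emb_re : forall z, 0 <= z -> emb (re z) = z;
  emb_ge0 : forall a, (0 <= emb a) = (0 <= a);
  re_embM : forall a z, re (emb a * z) = a * re z;
  re_le_norm : forall z, re z <= re `|z|;
  scalar_split : forall z, z = emb (re z) - iu * emb (re (iu * z));
  iu_cases : iu = 0 \/ iu * iu = -1 }.

Definition real_scalars (R : realType) : scalars R R.
Proof.
apply: (@Scalars R R idfun idfun 0) => //=.
- by move=> z; rewrite ler_norm.
- by move=> z; rewrite mul0r subr0.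
- by left.
Qed.

Definition complex_re (R : realType) (z : R[i]) : R := complex.Re z.

Lemma complex_re_additive (R : realType) : zmod_morphism (@complex_re R).
Proof. by move=> [a b] [c d]. Qed.

HB.instance Definition _ (R : realType) :=
  GRing.isZmodMorphism.Build R[i] R (@complex_re R) (@complex_re_additive R).

Definition complex_scalars (R : realType) : scalars R R[i].
Proof.
apply: (@Scalars R R[i] (real_complex R) (@complex_re R) (Complex 0 1)) => //.
- by move=> [a b]; rewrite lecE /= => /andP[/eqP->].
- by move=> a; rewrite lecE /= eqxx.
- by move=> a [b c] /=; rewrite /complex_re/= mul0r subr0.
- move=> [a b] /=; rewrite /complex_re /=.
  by rewrite (le_trans (ler_norm _))// -sqrtr_sqr ler_wsqrtr// lerDl sqr_ge0.
- move=> [a b] /=; rewrite /complex_re /=; apply/eqP; rewrite eq_complex/=.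
  by apply/andP; split; apply/eqP; ring.
- right; apply/eqP; rewrite eq_complex/=.
  by apply/andP; split; apply/eqP; ring.
Qed.

(* Norms take their values in K; rn x is the norm of x as an element of R,
   where real arithmetic is available. *)
Section ScalarTheory.
Variables (R : realType) (K : numFieldType) (S : scalars R K).
Local Notation emb := (emb S).
Local Notation re := (re S).
Local Notation iu := (iu S).
Local Notation rn x := (re `|x|).

Lemma emb_le a b : (emb a <= emb b) = (a <= b).
Proof. by rewrite -subr_ge0 -rmorphB emb_ge0 subr_ge0. Qed.
Lemma emb_lt a b : (emb a < emb b) = (a < b).
Proof. by rewrite !lt_def emb_le (can_eq (embK S)). Qed.
Lemma re_ge0 z : 0 <= z -> 0 <= re z.
Proof. by move=> z0; rewrite -(emb_ge0 S) emb_re. Qed.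
Lemma norm_emb a : `|emb a| = emb `|a|.
Proof.
have [a0|a0] := leP 0 a; first by rewrite !ger0_norm ?emb_ge0.
rewrite ler0_norm ?(ltr0_norm a0) ?rmorphN//.
by rewrite -oppr_ge0 -rmorphN emb_ge0 oppr_ge0 ltW.
Qed.

Section Norm.
Variable V : normedZmodType K.
Implicit Types x y : V.
Lemma emb_rn x : emb (rn x) = `|x|. Proof. by rewrite emb_re. Qed.
Lemma rn_ge0 x : 0 <= rn x. Proof. exact: re_ge0. Qed.
Lemma rnD x y : rn (x + y) <= rn x + rn y.
Proof. by rewrite -emb_le rmorphD !emb_rn ler_normD. Qed.
Lemma rnN x : rn (- x) = rn x. Proof. by rewrite normrN. Qed.
Lemma rn_le x a : (rn x <= a) = (`|x| <= emb a).
Proof. by rewrite -emb_le emb_rn. Qed.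
Lemma rn_lt x a : (rn x < a) = (`|x| < emb a).
Proof. by rewrite -emb_lt emb_rn. Qed.
Lemma rn0 : rn (0 : V) = 0. Proof. by rewrite normr0 raddf0. Qed.
Lemma rn_eq0 x : (rn x == 0) = (x == 0).
Proof. by rewrite -(can_eq (embK S)) emb_rn rmorph0 normr_eq0. Qed.
End Norm.

Lemma rnM (a b : K) : rn (a * b) = rn a * rn b.
Proof. by apply: (can_inj (embK S)); rewrite rmorphM !emb_rn normrM. Qed.
Lemma rnZ (V : normedModType K) (a : K) (x : V) : rn (a *: x) = rn a * rn x.
Proof. by apply: (can_inj (embK S)); rewrite rmorphM !emb_rn normrZ. Qed.
Lemma rn_emb a : rn (emb a) = `|a|.
Proof. by rewrite norm_emb embK. Qed.
Lemma rn1 : rn (1 : K) = 1.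
Proof. by rewrite -(rmorph1 emb) rn_emb normr1. Qed.

Lemma rn_iu : rn iu <= 1.
Proof.
case: (iu_cases S) => [->|h]; first by rewrite normr0 raddf0.
have : rn iu * rn iu = 1 by rewrite -rnM h normrN rn1.
have := rn_ge0 iu; nra.
Qed.

Lemma re_norm_le z : `|re z| <= rn z.
Proof.
by rewrite ler_norml re_le_norm andbT lerNl -raddfN -(rnN z) re_le_norm.
Qed.

Lemma emb_re_le z w : 0 <= z -> z <= w -> re z <= re w.
Proof. by move=> z0 zw; rewrite -subr_ge0 -raddfB re_ge0// subr_ge0. Qed.

(** In a partially ordered field the least upper bound may fail to exist; here
    it is the image of the one computed in R. *)
Lemma supremumP (A : set K) : A !=set0 -> (forall x, A x -> 0 <= x) ->
  (exists u, ubound A u) -> supremums A (supremum 0 A).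
Proof.
move=> [a Aa] A0 [u Au].
have u0 : 0 <= u by rewrite (le_trans (A0 _ Aa))// Au.
pose B := re @` A.
have hB : has_sup B.
  split; first by exists (re a), a.
  exists (re u) => _ [x Ax <-]; apply: emb_re_le; [exact: A0|exact: Au].
have sA : supremums A (emb (sup B)).
  split=> [x Ax|w Aw].
    rewrite -(emb_re S (A0 _ Ax)) emb_le; apply: ub_le_sup; first by case: hB.
    by exists x.
  have w0 : 0 <= w by rewrite (le_trans (A0 _ Aa))// Aw.
  rewrite -(emb_re S w0) emb_le; apply: ge_sup; first by case: hB.
  by move=> _ [x Ax <-]; apply: emb_re_le; [exact: A0|exact: Aw].
rewrite /supremum; case: ifPn => [/eqP A00|_]; first by rewrite A00 in Aa.
by case: xgetP => [y -> //|/(_ _ sA)].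
Qed.

Lemma infimumP (d : K) (A : set K) : A !=set0 -> (forall x, A x -> 0 <= x) ->
  infimums A (infimum d A).
Proof.
move=> [a Aa] A0.
pose B := re @` A.
have hB : has_inf B.
  split; first by exists (re a), a.
  by exists 0 => _ [x Ax <-]; apply: re_ge0; exact: A0.
have sA : infimums A (emb (inf B)).
  split=> [x Ax|w Aw].
    rewrite -(emb_re S (A0 _ Ax)) emb_le; apply: ge_inf; first by case: hB.
    by exists x.
  (* a lower bound need not be nonnegative, but it is real *)
  have -> : w = emb (re w).
    have := emb_re S (z := a - w); rewrite subr_ge0 Aw// => /(_ isT).
    by rewrite raddfB rmorphB /= (emb_re S (A0 _ Aa)) => /addrI/oppr_inj.
  rewrite emb_le; apply: lb_le_inf; first by case: hB.
  move=> _ [x Ax <-]; rewrite -subr_ge0 -raddfB re_ge0// subr_ge0.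
  exact: Aw.
rewrite /infimum; case: ifPn => [/eqP A00|_]; first by rewrite A00 in Aa.
by case: xgetP => [y -> //|/(_ _ sA)].
Qed.

End ScalarTheory.

(** * The Hahn-Banach theorem *)

Section HahnBanach.
Variables (R : realType) (K : numFieldType) (S : scalars R K).
Local Notation emb := (emb S).
Local Notation re := (re S).
Local Notation iu := (iu S).
Local Notation rn x := (re `|x|).

Section DominatedGraphs.
Variables (W : lmodType K) (p : W -> R).
Hypothesis p_sub : forall x y, p (x + y) <= p x + p y.
Hypothesis p_hom : forall t x, 0 <= t -> p (emb t *: x) = t * p x.

(** The graph of a real-linear map on a real subspace of W, bounded by p. That
    such a set is functional is a consequence (dominated_graph_fun), so unions of
    chains need no argument about single-valuedness. *)
Definition dominated_graph (G : set (W * R)) :=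
  [/\ G (0, 0),
      forall t x r y s, G (x, r) -> G (y, s) -> G (emb t *: x + y, t * r + s) &
      forall x r, G (x, r) -> r <= p x].

Lemma dominated_graphZ G t x r : dominated_graph G -> G (x, r) ->
  G (emb t *: x, t * r).
Proof.
by move=> [G0 GL _] Gx; have := GL t _ _ _ _ Gx G0; rewrite !addr0.
Qed.

Lemma dominated_graph_fun G x r s : dominated_graph G ->
  G (x, r) -> G (x, s) -> r = s.
Proof.
move=> [G0 GL Gp].
have p0 : p 0 = 0 by rewrite -(scale0r 0) -(rmorph0 emb) p_hom// mul0r.
have key a b : G (x, a) -> G (x, b) -> a <= b.
  move=> Ga Gb; have /Gp := GL (-1) _ _ _ _ Gb Ga.
  by rewrite rmorphN1 scaleN1r addNr p0 mulN1r addrC subr_le0.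
by move=> Gr Gs; apply/eqP; rewrite eq_le !key.
Qed.

Definition extend_graph (G : set (W * R)) (x0 : W) (c : R) : set (W * R) :=
  [set w | exists t y r,
    [/\ G (y, r), w.1 = y + emb t *: x0 & w.2 = r + t * c]].

Lemma extend_graph_sub G x0 c : G `<=` extend_graph G x0 c.
Proof.
by move=> [x r] Gx; exists 0, x, r; rewrite rmorph0 scale0r mul0r !addr0.
Qed.

(** The value c at the new vector x0 must separate the numbers r - p (y - x0)
    from the numbers p (z + x0) - s, for (y, r) and (z, s) in G. *)
Lemma extend_graphP G x0 : dominated_graph G ->
  exists c, dominated_graph (extend_graph G x0 c).
Proof.
move=> gG; have [G0 GL Gp] := gG.
have key y r z s : G (y, r) -> G (z, s) -> r - p (y - x0) <= p (z + x0) - s.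
  move=> Gy Gz; have /Gp := GL 1 _ _ _ _ Gy Gz.
  rewrite rmorph1 scale1r mul1r => h.
  have := p_sub (y - x0) (z + x0); rewrite addrACA addNr addr0.
  lra.
pose B := [set b | exists y r, G (y, r) /\ b = r - p (y - x0)].
have B0 : B !=set0 by exists (0 - p (0 - x0)), 0, 0.
have hB : has_sup B.
  by split=> //; exists (p (0 + x0) - 0) => _ [y [r [Gy ->]]]; exact: key.
exists (sup B); set c := sup B; split.
- exists 0, 0, 0; rewrite rmorph0 scale0r mul0r !addr0; split=> //.
- move=> t _ _ _ _ [u [y [r [Gy /= -> ->]]]] [v [z [s [Gz /= -> ->]]]].
  exists (t * u + v), (emb t *: y + z), (t * r + s); split => /=.
  + exact: GL.
  + by rewrite rmorphD rmorphM /= scalerDl scalerDr scalerA addrACA.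
  + by rewrite mulrDr mulrDl mulrA addrACA.
move=> _ _ [t [y [r [Gy /= -> ->]]]].
have cge z s : G (z, s) -> s - p (z - x0) <= c.
  by move=> Gz; apply: ub_le_sup; [case: hB|exists z, s].
have cle z s : G (z, s) -> c <= p (z + x0) - s.
  by move=> Gz; apply: ge_sup => // _ [y' [r' [Gy' ->]]]; exact: key.
have [t0|t0|->] := ltgtP t 0; last first.
- by rewrite rmorph0 scale0r mul0r !addr0; exact: Gp.
- have tV : emb t * emb t^-1 = 1 by rewrite -rmorphM divff ?rmorph1// gt_eqF.
  have /cle := dominated_graphZ t^-1 gG Gy.
  rewrite -(ler_pM2l t0) mulrBr mulrA divff ?gt_eqF// mul1r.
  rewrite -(p_hom _ (ltW t0)) scalerDr scalerA tV scale1r => h.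
  lra.
- have u0 : 0 < - t by rewrite oppr_gt0.
  have un0 : - t != 0 by rewrite gt_eqF.
  have tV : emb (- t) * emb (- t)^-1 = 1 by rewrite -rmorphM divff ?rmorph1.
  have /cge := dominated_graphZ (- t)^-1 gG Gy.
  rewrite -(ler_pM2l u0) mulrBr mulrA divff// mul1r.
  rewrite -(p_hom _ (ltW u0)) scalerBr scalerA tV scale1r rmorphN scaleNr opprK.
  lra.
Qed.

Lemma dominated_graph_total G0 : dominated_graph G0 ->
  exists G, [/\ dominated_graph G, G0 `<=` G & forall x, exists r, G (x, r)].
Proof.
move=> gG0; pose P G := dominated_graph (G0 `|` G).
(* G0 is added to every member so that the empty chain also has a bound. *)
have [|A [gA maxA]] := @Zorn_bigcup _ P.
  move=> F FP Ftot; rewrite /P; set U := \bigcup_(_ in _) _.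
  have common w w' : (G0 `|` U) w -> (G0 `|` U) w' ->
      exists H, [/\ dominated_graph H, H `<=` G0 `|` U, H w & H w'].
    have sub H : F H -> G0 `|` H `<=` G0 `|` U.
      by move=> FH; apply: setUS => z Hz; exists H.
    move=> [w0|[H FH Hw]] [w'0|[H' FH' Hw']].
    - by exists G0; split => // z; left.
    - by exists (G0 `|` H'); split; [exact: FP|exact: sub|left|right].
    - by exists (G0 `|` H); split; [exact: FP|exact: sub|right|left].
    have [HH|HH] := Ftot _ _ FH FH'.
      exists (G0 `|` H'); split; [exact: FP|exact: sub| |by right].
      by right; exact: HH.
    by exists (G0 `|` H); split; [exact: FP|exact: sub|right|right; exact: HH].
  split; first by left; case: gG0.
    move=> t x r y s wx wy; have [H [[_ HL _] HU Hx Hy]] := common _ _ wx wy.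
    by apply: HU; exact: HL.
  by move=> x r wx; have [H [[_ _ Hp] _ Hx _]] := common _ _ wx wx; exact: Hp.
exists (G0 `|` A); split=> [//|z|x0]; first by left.
apply: contrapT => nx0.
have [c gc] := extend_graphP x0 gA.
have sub := @extend_graph_sub (G0 `|` A) x0 c.
apply: (maxA (extend_graph (G0 `|` A) x0 c)).
  split; first by apply: subset_trans sub; exact: subsetUr.
  move=> h; apply: nx0; exists c; right; apply: h.
  exists 1, 0, 0; rewrite rmorph1 scale1r mul1r !add0r; split=> //.
  by case: gA.
rewrite /P (_ : _ `|` _ = extend_graph (G0 `|` A) x0 c)//.
by apply/setUidPr; apply: subset_trans sub; exact: subsetUl.
Qed.

End DominatedGraphs.

(** In the real case iu is 0; in the complex case scalar_split at 1 forces it. *)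
Lemma re_iu : re iu = 0.
Proof.
case: (iu_cases S) => [->|hi]; first by rewrite raddf0.
have re1 : re 1 = 1 by rewrite -(rmorph1 emb) embK.
have := scalar_split S 1; rewrite re1 rmorph1 mulr1 => /eqP.
rewrite -subr_eq0 opprB addrC subrK mulf_eq0 => /orP[/eqP i0|].
  by move: hi; rewrite i0 mul0r => /esym/eqP; rewrite oppr_eq0 oner_eq0.
by rewrite -(rmorph0 emb) (can_eq (embK S)) => /eqP.
Qed.

(** The real part of f extends to a real-linear map h bounded by p, and
    g x = h x - iu * h (iu *: x) is the K-linear map with real part h. *)
Theorem hahn_banach (W : lmodType K) (p : W -> R) (F : set W) (f : W -> K^o) :
  (forall x y, p (x + y) <= p x + p y) ->
  (forall a x, p (a *: x) = rn a * p x) ->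
  linear_subspace F ->
  (forall a u v, F u -> F v -> f (a *: u + v) = a *: f u + f v) ->
  (forall x, F x -> rn (f x) <= p x) ->
  exists g : W -> K^o,
    [/\ linear g, forall x, F x -> g x = f x & forall x, rn (g x) <= p x].
Proof.
move=> p_sub p_hom [F0 FL] fL fp.
have p_rhom t x : 0 <= t -> p (emb t *: x) = t * p x.
  by move=> t0; rewrite p_hom rn_emb ger0_norm.
have f0 : f 0 = 0.
  by have := fL (-1) _ _ F0 F0; rewrite scaler0 addr0 scaleN1r addNr.
have fZ a u : F u -> f (a *: u) = a *: f u.
  by move=> Fu; have := fL a _ _ Fu F0; rewrite addr0 f0 addr0.
pose G0 : set (W * R) := [set w | F w.1 /\ w.2 = re (f w.1)].
have gG0 : dominated_graph p G0.
  split; first by rewrite /G0/= f0 raddf0.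
    move=> t x r y s [/= Fx ->] [/= Fy ->]; split; first exact: FL.
    by rewrite /= fL// raddfD/= re_embM.
  by move=> x r [/= Fx ->]; rewrite (le_trans (re_le_norm S _))// fp.
have [G [gG G0G tot]] := dominated_graph_total p_sub p_rhom gG0.
have [h hG] := choice tot.
have hE x r : G (x, r) -> h x = r.
  by move=> Gx; exact: dominated_graph_fun gG _ Gx.
have [_ GL Gp] := gG.
have hL t x y : h (emb t *: x + y) = t * h x + h y by apply: hE; exact: GL.
have h0 : h 0 = 0 by apply: hE; case: gG.
have hD x y : h (x + y) = h x + h y.
  by have := hL 1 x y; rewrite rmorph1 scale1r mul1r.
have hZ t x : h (emb t *: x) = t * h x.
  by have := hL t x 0; rewrite !addr0 h0 addr0.
pose g (x : W) : K^o := emb (h x) - iu * emb (h (iu *: x)).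
have gD x y : g (x + y) = g x + g y.
  by rewrite /g scalerDr !hD !rmorphD /=; ring.
have gZr t x : g (emb t *: x) = emb t * g x.
  by rewrite /g scalerA (mulrC iu (emb t)) -scalerA !hZ !rmorphM /=; ring.
have hN x : h (- x) = - h x.
  by apply: (addrI (h x)); rewrite -hD !subrr.
have giu x : g (iu *: x) = iu * g x.
  rewrite /g scalerA; case: (iu_cases S) => hi; last first.
    by rewrite mulrBr mulrA hi scaleN1r hN rmorphN/=; ring.
  by rewrite hi !mul0r scale0r h0 rmorph0 subr0.
have gN y : g (- y) = - g y.
  by rewrite -scaleN1r -(rmorphN1 emb) gZr rmorphN1 mulN1r.
have gZ a x : g (a *: x) = a * g x.
  rewrite (scalar_split S a); move: (re a) (re (iu * a)) => s t.
  by rewrite scalerBl gD gN -scalerA giu !gZr; ring.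
have reg x : re (g x) = h x.
  by rewrite /g raddfB /= embK mulrC re_embM re_iu mulr0 subr0.
exists g; split.
- by move=> a x y; rewrite gD gZ.
- move=> x Fx; rewrite /g (hE x (re (f x))); last by apply: G0G.
  rewrite (hE _ (re (iu * f x))); last first.
    apply: G0G; split; last by rewrite /= fZ.
    by have := FL iu _ _ Fx F0; rewrite addr0.
  by rewrite -scalar_split.
- move=> x; have [gx0|gx0] := eqVneq (g x) 0.
    have p0 : p 0 = 0 by have := p_hom 0 0; rewrite scale0r normr0 raddf0 mul0r.
    have := p_sub x (- x); rewrite subrr p0 -scaleN1r p_hom normrN1.
    rewrite -(rmorph1 emb) embK mul1r gx0 normr0 raddf0; lra.
  (* rotate x so that g takes a nonnegative value *)
  pose c := `|g x| / g x.
  have c1 : rn c = 1.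
    by rewrite normrM normfV normr_id divff ?normr_eq0// -(rmorph1 emb) embK.
  have -> : rn (g x) = h (c *: x) by rewrite -reg gZ /c divfK.
  by rewrite (le_trans (Gp _ _ (hG _)))// p_hom c1 mul1r.
Qed.

End HahnBanach.

(** * Operator norm and numerical radius *)

Section BoundedOperators.
Variables (R : realType) (K : numFieldType) (S : scalars R K).
Local Notation emb := (emb S).
Local Notation re := (re S).
Local Notation rn x := (re `|x|).

Lemma re_normM (V : normedZmodType K) (v : V) z : re (`|v| * z) = rn v * re z.
Proof. by rewrite -(emb_rn S v) re_embM embK. Qed.

Section Operators.
Variables (E : lmodType K) (N : E -> K) (F : normedModType K).
Implicit Types (f g : boundedOp N F).

Lemma bop_linear f : linear f.
Proof. by have /asboolP[] := boundedOpP f. Qed.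

HB.instance Definition _ f := GRing.isLinear.Build K E F *:%R f (bop_linear f).

Lemma bop_addr f x y : f (x + y) = f x + f y.
Proof. exact: (linearD f). Qed.
Lemma bop_oppr f x : f (- x) = - f x.
Proof. exact: (linearN f). Qed.
Lemma bop_scaler f a x : f (a *: x) = a *: f x.
Proof. by rewrite linearZ. Qed.

Lemma bopD f g x : (f + g) x = f x + g x. Proof. by []. Qed.
Lemma bopB f g x : (f - g) x = f x - g x. Proof. by []. Qed.
Lemma bopZ a f x : (a *: f) x = a *: f x. Proof. by []. Qed.

Hypothesis N_ge0 : forall x, 0 <= N x.
Hypothesis N_Z : forall a x, N (a *: x) = `|a| * N x.

Lemma bounded_linearP (f : E -> F) c : linear f ->
  (forall x, rn (f x) <= c * re (N x)) -> f \in @bounded_linear K E N F.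
Proof.
move=> lf fc; apply/asboolP; split=> //; exists (emb c) => x.
by rewrite -(emb_re S (N_ge0 x)) -rmorphM -(rn_le S) fc.
Qed.

Lemma bop_bounded f : exists2 c, 0 <= c & forall x, rn (f x) <= c * re (N x).
Proof.
have /asboolP[_ [C fC]] := boundedOpP f.
exists (rn C) => [|x]; first exact: rn_ge0.
have CN0 : 0 <= C * N x by rewrite (le_trans _ (fC x)).
have : rn (f x) <= rn (C * N x).
  by apply: emb_re_le; rewrite // (ger0_norm CN0) fC.
by rewrite rnM (ger0_norm (N_ge0 x)).
Qed.

Let img f := [set `|f x| | x in [set x | N x <= 1]].

Let opnorm_supremums f : supremums (img f) (opnorm f).
Proof.
have [c c0 fc] := bop_bounded f; apply: (supremumP S).
- exists `|f 0|, 0 => //; rewrite /= -(scale0r 0) N_Z normr0 mul0r.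
  exact: ler01.
- by move=> _ [x _ <-].
- exists (emb c) => _ [x /= Nx <-]; rewrite -(rn_le S) (le_trans (fc x))//.
  rewrite ler_piMr// -(embK S 1) rmorph1.
  by apply: emb_re_le.
Qed.

Lemma opnorm_ge0 f : 0 <= opnorm f.
Proof.
have [ub _] := opnorm_supremums f; apply: le_trans (ub `|f 0| _) => //.
by exists 0 => //=; rewrite -(scale0r 0) N_Z normr0 mul0r ler01.
Qed.

Lemma emb_opnorm f : emb (re (opnorm f)) = opnorm f.
Proof. by rewrite emb_re ?opnorm_ge0. Qed.

Lemma opnorm_le f c : (forall x, re (N x) <= 1 -> rn (f x) <= c) ->
  re (opnorm f) <= c.
Proof.
move=> fc; have [_ lub] := opnorm_supremums f.
rewrite -(emb_le S) emb_opnorm; apply: lub => _ [x /= Nx <-].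
rewrite -(rn_le S) fc// -(emb_le S) rmorph1 emb_re//.
Qed.

Lemma le_opnorm f x : rn (f x) <= re (opnorm f) * re (N x).
Proof.
have [ub _] := opnorm_supremums f.
have [Nx0|Nx0] := eqVneq (re (N x)) 0.
  by have [c _ /(_ x)] := bop_bounded f; rewrite Nx0 !mulr0.
have Nx_gt0 : 0 < re (N x) by rewrite lt_def Nx0 re_ge0.
rewrite -ler_pdivrMr// -(emb_le S) emb_opnorm; apply: ub.
have k0 : 0 <= emb (re (N x))^-1 by rewrite emb_ge0 invr_ge0 ltW.
exists (emb (re (N x))^-1 *: x) => /=.
  rewrite N_Z (ger0_norm k0) -[N x](emb_re S)// -rmorphM /= embK.
  by rewrite mulVf// rmorph1.
by rewrite linearZ normrZ (ger0_norm k0) rmorphM /= emb_rn mulrC.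
Qed.

End Operators.

Section NumericalRadius.
Variable X : normedModType K.
Implicit Types (T : operators X) (f : dual X).

(* The two norm axioms, in the form in which // finds them. *)
Let NX0 (x : X) : 0 <= `|x| := normr_ge0 x.
Let NXZ (a : K) (x : X) : `|a *: x| = `|a| * `|x| := normrZ a x.

Lemma le_norm_op T x : rn (T x) <= re (opnorm T) * rn x.
Proof. exact: le_opnorm. Qed.

Lemma le_norm_dual f x : rn (f x) <= re (opnorm f) * rn x.
Proof. exact: le_opnorm. Qed.

Lemma norming_pair_bound (T : operators X) p : @norming_pairs K X p ->
  rn (p.1 (T p.2)) <= re (opnorm T).
Proof.
move=> [p1 p2 _]; have := le_norm_dual p.1 (T p.2); rewrite p1.
rewrite -{1}(rmorph1 emb) embK mul1r => /le_trans; apply.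
by have := le_norm_op T p.2; rewrite p2 -{1}(rmorph1 emb) embK mulr1.
Qed.

Let vimg T := [set `|p.1 (T p.2)| | p in @norming_pairs K X].

Let radius_cases T : (numerical_radius T = 0 /\ vimg T = set0) \/
  supremums (vimg T) (numerical_radius T).
Proof.
have [h|/set0P h] := eqVneq (vimg T) set0.
  by left; split => //; rewrite /numerical_radius -/(vimg T) h supremum0.
right; apply: (supremumP S) => //; first by move=> _ [p _ <-].
exists (emb (re (opnorm T))) => _ [p hp <-]; rewrite -(rn_le S).
exact: norming_pair_bound.
Qed.

Lemma radius_ge T p : @norming_pairs K X p ->
  `|p.1 (T p.2)| <= numerical_radius T.
Proof.
move=> hp; have vp : vimg T `|p.1 (T p.2)| by exists p.
by case: (radius_cases T) => [[_ h]|[ub _]]; [rewrite h in vp|exact: ub].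
Qed.

Lemma radius_ge0 T : 0 <= numerical_radius T.
Proof.
case: (radius_cases T) => [[-> _]//|]; rewrite /supremums => -[ub lub].
have [h|/set0P[_ [p hp _]]] := eqVneq (vimg T) set0.
  by rewrite /numerical_radius -/(vimg T) h supremum0.
by rewrite (le_trans _ (radius_ge T hp)).
Qed.

Lemma radius_le T c : 0 <= c ->
  (forall p, @norming_pairs K X p -> rn (p.1 (T p.2)) <= c) ->
  re (numerical_radius T) <= c.
Proof.
move=> c0 h; rewrite -(emb_le S) emb_re ?radius_ge0//.
case: (radius_cases T) => [[-> _]|[_ lub]]; first by rewrite emb_ge0.
by apply: lub => _ [p hp <-]; rewrite -(rn_le S) h.
Qed.

Lemma radius_le_opnorm T : re (numerical_radius T) <= re (opnorm T).
Proof.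
apply: radius_le => [|p]; last exact: norming_pair_bound.
exact/re_ge0/opnorm_ge0.
Qed.

Lemma radiusZ a T : numerical_radius (a *: T) = `|a| * numerical_radius T.
Proof.
have key (b : K) (U : operators X) :
    re (numerical_radius (b *: U)) <= rn b * re (numerical_radius U).
  apply: radius_le => [|p hp].
    by rewrite mulr_ge0 ?rn_ge0 ?re_ge0 ?radius_ge0.
  rewrite bopZ linearZ normrZ re_normM ler_wpM2l ?rn_ge0//.
  exact: emb_re_le (radius_ge _ hp).
suff e : re (numerical_radius (a *: T)) = rn a * re (numerical_radius T).
  rewrite -[LHS](emb_re S) ?radius_ge0// e rmorphM /= emb_rn.
  by rewrite emb_re ?radius_ge0.
apply/eqP; rewrite eq_le key /=.
have [->|a0] := eqVneq a 0; first by rewrite (rn0 S) mul0r re_ge0 ?radius_ge0.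
have := key a^-1 (a *: T); rewrite scalerA mulVf// scale1r.
have ra : 0 < rn a by rewrite lt_def rn_eq0 a0 rn_ge0.
move=> /(ler_wpM2l (ltW ra)); rewrite mulrA -rnM mulfV//.
by rewrite rn1 mul1r.
Qed.

Lemma opnormZ a T : re (opnorm (a *: T)) = rn a * re (opnorm T).
Proof.
have key (b : K) (U : operators X) :
    re (opnorm (b *: U)) <= rn b * re (opnorm U).
  apply: opnorm_le => // x x1.
  rewrite bopZ (rnZ S) ler_wpM2l ?rn_ge0// (le_trans (le_norm_op _ _))//.
  by rewrite ler_piMr// re_ge0// opnorm_ge0.
apply/eqP; rewrite eq_le key /=.
have [->|a0] := eqVneq a 0; first by rewrite (rn0 S) mul0r re_ge0 ?opnorm_ge0.
have := key a^-1 (a *: T); rewrite scalerA mulVf// scale1r.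
have ra : 0 < rn a by rewrite lt_def rn_eq0 a0 rn_ge0.
move=> /(ler_wpM2l (ltW ra)); rewrite mulrA -rnM mulfV//.
by rewrite rn1 mul1r.
Qed.

(** The infimum of an empty set is 1 in the definition of the index: no operator
    has norm 1 only if all operators vanish, and then n = 1 works. *)
Lemma index_gt_half : 2%:R^-1 < numerical_index X ->
  exists2 n : R, 2^-1 < n &
    forall T : operators X, n * re (opnorm T) <= re (numerical_radius T).
Proof.
rewrite /numerical_index; set A := image _ _ => hn.
have normalize T : re (opnorm T) != 0 ->
    opnorm (emb (re (opnorm T))^-1 *: T) = 1.
  move=> T0; rewrite -emb_opnorm// opnormZ rn_emb.
  by rewrite ger0_norm ?invr_ge0 ?re_ge0 ?opnorm_ge0// mulVf// rmorph1.
have [A0|/set0P A0] := eqVneq A set0.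
  exists 1 => [|T]; first by rewrite invf_lt1// ltr1n.
  have [->|/normalize T1] := eqVneq (re (opnorm T)) 0.
    by rewrite mulr0 re_ge0 ?radius_ge0.
  have : A (numerical_radius (emb (re (opnorm T))^-1 *: T)).
    by exists (emb (re (opnorm T))^-1 *: T).
  by rewrite A0.
have A_ge0 x : A x -> 0 <= x by move=> [T _ <-]; exact: radius_ge0.
have [lb _] := infimumP S 1 A0 A_ge0.
have I0 : 0 <= infimum 1 A by rewrite ltW// (lt_trans _ hn)// invr_gt0 ltr0n.
exists (re (infimum 1 A)) => [|T].
  by rewrite -(emb_lt S) emb_re// fmorphV rmorph_nat.
have [->|T0] := eqVneq (re (opnorm T)) 0.
  by rewrite mulr0 re_ge0 ?radius_ge0.
have T_gt0 : 0 < re (opnorm T) by rewrite lt_def T0 re_ge0 ?opnorm_ge0.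
have /lb : A (numerical_radius (emb (re (opnorm T))^-1 *: T)).
  by exists (emb (re (opnorm T))^-1 *: T) => //; exact: normalize.
have iT : 0 <= (re (opnorm T))^-1 by rewrite invr_ge0 ltW.
rewrite radiusZ norm_emb (ger0_norm iT) => /(emb_re_le S I0).
by rewrite re_embM ler_pdivlMl// mulrC.
Qed.

(** A Hahn-Banach extension of a *: x |-> a * |x| from the line through x. *)
Lemma support_functional (x : X) : exists f : dual X,
  (forall y, rn (f y) <= rn y) /\ f x = `|x|.
Proof.
have [->|x0] := eqVneq x 0.
  exists 0; split=> [y|]; last by rewrite normr0.
  by rewrite -[X in re `|X|]/(0 : K^o) normr0 raddf0 rn_ge0.
(* The coordinate on the line through x, extended by 0. *)
pose co y := xget 0 [set a : K | y = a *: x].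
have coE a : co (a *: x) = a.
  rewrite /co; case: xgetP => [b _ /= /eqP|/(_ a)]; last by case.
  rewrite -subr_eq0 -scalerBl scaler_eq0 (negPf x0) orbF subr_eq0.
  by move=> /eqP.
have [||||x1|g [lg gF gb]] := @hahn_banach _ _ S X (fun y => rn y)
  [set y | exists a, y = a *: x] (fun y => co y * `|x|).
- exact: rnD.
- exact: rnZ.
- split; first by exists 0; rewrite scale0r.
  by move=> a _ _ [b ->] [c ->]; exists (a * b + c); rewrite scalerDl scalerA.
- move=> a _ _ [b ->] [c ->]; rewrite scalerA -scalerDl !coE mulrDl.
  by rewrite -mulrA.
- by move=> [b ->]; rewrite coE rnM rnZ normr_id.
have hg : g \in @bounded_linear K X (@Num.norm K X) K^o.
  by apply: (@bounded_linearP _ _ _ _ g 1) => // y; rewrite mul1r.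
exists (BoundedOp hg); split => //=.
rewrite gF; first by rewrite -[x in co x]scale1r coE mul1r.
by exists 1; rewrite scale1r.
Qed.

(** Evaluate at a support functional of y, which forms with y / |y| a pair
    of Pi(X). *)
Lemma radius_one_lower_bound T t y : 0 <= t -> re (numerical_radius T) <= 1 ->
  (1 - t) * rn y <= rn (y - emb t *: T y).
Proof.
move=> t0 vT; have [->|y0] := eqVneq y 0; first by rewrite (rn0 S) mulr0 rn_ge0.
have ny : 0 < rn y by rewrite lt_def rn_eq0 y0 rn_ge0.
have [f [fb fy]] := support_functional y.
have iy : 0 <= (rn y)^-1 by rewrite invr_ge0 ltW.
have f1 : opnorm f = 1.
  rewrite -emb_opnorm//; congr (emb _ = _): (rmorph1 emb).
  apply/eqP; rewrite eq_le; apply/andP; split.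
    have := le_norm_dual f y; rewrite fy normr_id.
    by rewrite -{1}[rn y]mul1r ler_pM2r.
  by apply: opnorm_le => // z; apply: le_trans.
have yV : emb (rn y)^-1 * `|y| = 1.
  by rewrite -[X in _ * X](emb_rn S) -rmorphM mulVf ?rmorph1// gt_eqF.
have p1 : @norming_pairs K X (f, emb (rn y)^-1 *: y).
  split => //=.
    by rewrite normrZ norm_emb (ger0_norm iy).
  by rewrite linearZ/= fy.
have fTy : rn (f (T y)) <= rn y.
  have := emb_re_le S (normr_ge0 _) (radius_ge T p1).
  rewrite /= !linearZ/= normrZ norm_emb (ger0_norm iy).
  by rewrite re_embM ler_pdivrMl// => /le_trans -> //; rewrite ler_piMr// ltW.
have := fb (y - emb t *: T y); rewrite linearB linearZ/=.
move=> /(le_trans _); apply.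
have := rnD S (f y - emb t * f (T y)) (emb t * f (T y)).
have nfy : rn (f y) = rn y by rewrite fy normr_id.
rewrite subrK rnM rn_emb (ger0_norm t0) nfy => h.
have := ler_wpM2l t0 fTy; lra.
Qed.

(** Lumer's formula replaces an approximation of (f, x) by a pair of Pi(X). After
    a rotation U of T by a unimodular scalar, apply the previous lemma to
    w = x + t U x: as w - t U w = x - t^2 U (U x), it gives
    (1 - t) |w| <= 1 + 4 t^2, whereas |w| >= f(w) = a + t |f(T x)|. *)
Lemma almost_norming_pair (f : X -> K^o) x T a t : linear f ->
  (forall y, rn (f y) <= rn y) -> rn x <= 1 -> f x = emb a ->
  0 < t -> t <= 2^-1 -> 1 - t ^+ 2 <= a ->
  re (numerical_radius T) <= 1 -> re (opnorm T) <= 2 ->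
  rn (f (T x)) <= 1 + 12 * t.
Proof.
move=> lf fb x1 fx t0 t1 at2 vT oT.
have [c c1 cE] : exists2 c : K, rn c = 1 & c * f (T x) = `|f (T x)|.
  have [->|z0] := eqVneq (f (T x)) 0.
    by exists 1; rewrite ?rn1// mulr0 normr0.
  exists (`|f (T x)| / f (T x)); last by rewrite divfK.
  by rewrite normrM normfV normr_id divff ?normr_eq0// -(rmorph1 emb) embK.
have [U [UE oU vU]] : exists U : operators X, [/\ forall z, U z = c *: T z,
    re (opnorm U) <= 2 & re (numerical_radius U) <= 1].
  exists (c *: T); split=> [//||]; first by rewrite opnormZ c1 mul1r.
  by rewrite radiusZ re_normM c1 mul1r.
pose w := x + emb t *: U x.
have wE : w - emb t *: U w = x - emb (t ^+ 2) *: U (U x).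
  rewrite /w bop_addr bop_scaler scalerDr opprD addrA addrK scalerA.
  by rewrite -rmorphM expr2.
have Uz z : rn (U z) <= 2 * rn z.
  by rewrite (le_trans (le_norm_op _ _))// ler_wpM2r ?rn_ge0.
have w_le : (1 - t) * rn w <= 1 + 4 * t ^+ 2.
  have := radius_one_lower_bound w (ltW t0) vU; rewrite wE => /le_trans; apply.
  have t20 : 0 <= t ^+ 2 by rewrite sqr_ge0.
  rewrite (le_trans (rnD S _ _))// (rnN S) (rnZ S) rn_emb ger0_norm//.
  rewrite lerD// mulrC ler_wpM2r// (le_trans (Uz _))//.
  by have := Uz x; lra.
have fD y z : f (y + z) = f y + f z.
  by have := lf 1 y z; rewrite !scale1r.
have fZ k y : f (k *: y) = k * f y.
  have f0 : f 0 = 0 by apply: (addrI (f 0)); rewrite -fD !addr0.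
  by have := lf k y 0; rewrite f0 !addr0.
have w_ge : a + t * rn (f (T x)) <= rn w.
  apply: le_trans (fb w); rewrite /w fD fZ UE fZ cE fx -(emb_rn S).
  by rewrite -rmorphM -rmorphD rn_emb embK ler_norm.
move: (rn (f (T x))) (rn w) w_le w_ge => s rw w_le w_ge.
have t1' : 0 < 1 - t by lra.
have h : (1 - t) * (1 - t ^+ 2 + t * s) <= 1 + 4 * t ^+ 2.
  apply: le_trans w_le; rewrite ler_pM2l//; lra.
rewrite -(ler_pM2l t1') -(ler_pM2l t0).
have : 0 <= t ^+ 2 * (6 - 11 * t) by rewrite mulr_ge0 ?sqr_ge0//; lra.
nra.
Qed.

End NumericalRadius.
End BoundedOperators.

(** * Limits along an ultrafilter *)

Section UltraLimits.
Variables (R : realType) (K : numFieldType) (S : scalars R K).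
Local Notation emb := (emb S).
Local Notation re := (re S).
Local Notation iu := (iu S).
Local Notation rn x := (re `|x|).

(** A compact set that contains the closed ball of radius c; using a continuous
    image of a square spares the topology of K. *)
Definition scalar_box (c : R) : set K^o :=
  (fun w : R * R => emb w.1 - iu * emb w.2 : K^o) @`
    ([set` `[- c, c]] `*` [set` `[- c, c]]).

Lemma mem_scalar_box c (z : K) : rn z <= c -> scalar_box c z.
Proof.
move=> zc; exists (re z, re (iu * z)); last by rewrite /= -scalar_split.
have h w : rn w <= rn z -> [set` `[- c, c]] (re w).
  move=> wz; rewrite /= in_itv /= -ler_norml.
  by rewrite (le_trans (re_norm_le S w))// (le_trans wz).
split => /=; apply: h => //.
by rewrite rnM ler_piMl ?rn_ge0 ?rn_iu.
Qed.

Lemma scalar_box_compact c : compact (scalar_box c).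
Proof.
apply: continuous_compact; last first.
  by apply: compact_setX; exact: segment_compact.
apply: continuous_subspaceT.
have ce : continuous (emb : R -> K^o).
  move=> x; apply/cvgrPdist_lt => e e0.
  near=> y; rewrite -rmorphB norm_emb -[e](emb_re S (ltW e0)) emb_lt.
  near: y; apply: (@cvgr_dist_lt _ _ _ _ _ (fun y : R => y) x) => //.
  by rewrite -(emb_lt S) rmorph0 emb_re// ltW.
move=> w; apply: cvgB.
  by apply: (continuous_comp (f := fst)); [exact: cvg_fst|exact: ce].
apply: cvgM; first exact: cvg_cst.
by apply: (continuous_comp (f := snd)); [exact: cvg_snd|exact: ce].
Unshelve. all: by end_near. Qed.

Lemma rank_one_precompact (X : normedModType K) (f : X -> K) c (v : X) :
  (forall x, `|x| <= 1 -> rn (f x) <= c) ->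
  precompact ((fun x => f x *: v) @` [set x | `|x| <= 1]).
Proof.
move=> fc; apply: (@precompact_subset _ _
  ((fun k : K^o => k *: v) @` scalar_box c)).
  move=> _ [x /= x1 <-]; exists (f x) => //.
  by apply: mem_scalar_box; exact: fc.
apply: compact_precompact; first exact: norm_hausdorff.
apply: continuous_compact; last exact: scalar_box_compact.
exact/continuous_subspaceT/scalel_continuous.
Qed.

Variable U : set_system nat.
Hypothesis ultraU : UltraFilter U.

Section Limits.
Variable V : normedModType K.
Implicit Types (u v : nat -> V) (l m : V).

(** Stated with real bounds, so that estimates of limits take place in R. *)
Definition ucvg u l := forall e : R, 0 < e -> U [set n | rn (u n - l) < e].

Lemma ucvg_point u l (A : set nat) (e : R) : ucvg u l -> 0 < e -> U A ->
  exists2 n, A n & rn (u n - l) < e.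
Proof.
move=> ul e0 UA; have [n [An ?]] := filter_ex (filterI UA (ul _ e0)).
by exists n.
Qed.

Lemma ucvg_uniq u l m : ucvg u l -> ucvg u m -> l = m.
Proof.
move=> ul um; apply/eqP; rewrite -subr_eq0 -(rn_eq0 S) eq_le rn_ge0 andbT.
apply/ler_addgt0Pl => e e0; rewrite addr0.
have e2 : 0 < e / 2 by rewrite divr_gt0.
have [n /= h1 h2] := ucvg_point um e2 (ul _ e2).
have -> : l - m = (u n - m) - (u n - l) by rewrite opprB [RHS]addrC addrA subrK.
have := rnD S (u n - m) (- (u n - l)); rewrite rnN; lra.
Qed.

Lemma ucvg_cst l : ucvg (fun=> l) l.
Proof.
by move=> e e0; apply: filterS filterT => n _ /=; rewrite subrr (rn0 S).
Qed.

Lemma ucvgD u v l m : ucvg u l -> ucvg v m ->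
  ucvg (fun n => u n + v n) (l + m).
Proof.
move=> ul vm e e0; have e2 : 0 < e / 2 by rewrite divr_gt0.
apply: filterS (filterI (ul _ e2) (vm _ e2)) => n [/= h1 h2].
by rewrite opprD addrACA (le_lt_trans (rnD S _ _))//; lra.
Qed.

Lemma ucvgZ a u l : ucvg u l -> ucvg (fun n => a *: u n) (a *: l).
Proof.
move=> ul e e0; have k0 : 0 < rn a + 1 by rewrite ltr_wpDl ?rn_ge0.
have d0 : 0 < e / (rn a + 1) by rewrite divr_gt0.
apply: filterS (ul _ d0) => n /=; rewrite ltr_pdivlMr// => h.
rewrite -scalerBr (rnZ S); have := rn_ge0 S (u n - l); lra.
Qed.

Lemma ucvg_norm_le u l c : ucvg u l -> U [set n | rn (u n) <= c] -> rn l <= c.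
Proof.
move=> ul uc; apply/ler_addgt0Pl => e e0.
have [n /= h1 h2] := ucvg_point ul e0 uc.
have := rnD S (u n) (- (u n - l)); rewrite (rnN S) opprB addrC subrK; lra.
Qed.

(** A cluster point of an ultrafilter is a limit. *)
Lemma ucvg_compact u (A : set V) : compact A -> (forall n, A (u n)) ->
  exists2 l, A l & ucvg u l.
Proof.
move=> Ac Au.
have UA : U (u @^-1` A) by apply: (filterS _ filterT) => n _; exact: Au.
have [l [Al cl]] := Ac (u @ U) _ UA.
exists l => // e e0; set B := [set n | _].
have [//|nB] := in_ultra_setVsetC B ultraU.
have Bl : nbhs l (ball l (emb e)).
  by apply: nbhsx_ballx; rewrite -(rmorph0 emb) emb_lt.
have Un : U (u @^-1` [set x | ~ ball l (emb e) x]).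
  apply: (filterS _ nB) => n; apply: contra_not => /=.
  by rewrite -ball_normE /B/= rn_lt distrC.
by have [x [nx bx]] := cl _ _ Un Bl.
Qed.

End Limits.

Section ScalarLimits.
Implicit Types (u v : nat -> K^o) (l m : K^o).

Lemma ucvg_re u l : ucvg u l -> forall e, 0 < e ->
  U [set n | `|re (u n) - re l| < e].
Proof.
move=> ul e e0; apply: filterS (ul _ e0) => n /=; apply: le_lt_trans.
by rewrite -raddfB re_norm_le.
Qed.

Lemma ucvg_re_le u v l m : ucvg u l -> ucvg v m ->
  U [set n | re (u n) <= re (v n)] -> re l <= re m.
Proof.
move=> ul vm uv; apply/ler_addgt0Pl => e e0.
have e2 : 0 < e / 2 by rewrite divr_gt0.
have [n /= [h1 [h2 h3]]] :=
  filter_ex (filterI uv (filterI (ucvg_re ul e2) (ucvg_re vm e2))).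
move: h2 h3; rewrite !ltr_distl => /andP[h2 _] /andP[_ h3]; lra.
Qed.

Definition ulim u : K := xget 0 [set l | ucvg u l].

Lemma ulimP u c : (forall n, rn (u n) <= c) -> ucvg u (ulim u).
Proof.
move=> uc; have [l _ ul] := ucvg_compact (@scalar_box_compact c)
  (fun n => mem_scalar_box (uc n)).
by rewrite /ulim; case: xgetP => [x -> //|/(_ l)].
Qed.

Lemma ulimE u l : ucvg u l -> ulim u = l.
Proof.
move=> ul; rewrite /ulim; case: xgetP => [x _ /= ux|/(_ l)//].
exact: ucvg_uniq ux ul.
Qed.

End ScalarLimits.
End UltraLimits.

(** * Separable subspaces with a nonseparable dual *)

Section LinearFunctions.
Variables (K : numFieldType) (V W : lmodType K) (f : V -> W).
Hypothesis lf : linear f.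

Lemma lin_D x y : f (x + y) = f x + f y.
Proof. by have := lf 1 x y; rewrite !scale1r. Qed.
Lemma lin_0 : f 0 = 0.
Proof. by apply: (addrI (f 0)); rewrite -lin_D !addr0. Qed.
Lemma lin_Z a x : f (a *: x) = a *: f x.
Proof. by have := lf a x 0; rewrite lin_0 !addr0. Qed.
Lemma lin_B x y : f (x - y) = f x - f y.
Proof. by rewrite lin_D -[- y]scaleN1r lin_Z scaleN1r. Qed.

End LinearFunctions.

(** Induction on m: on the kernel of v m inside F the functional is a combination
    of the others, and one vector outside that kernel fixes the last
    coefficient. *)
Lemma span_of_kernels (K : numFieldType) (W : lmodType K) (v : nat -> W -> K^o)
    (m : nat) (F : set W) (f : W -> K^o) :
  (forall k, linear (v k)) -> linear f -> linear_subspace F ->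
  (forall x, F x -> (forall k, (k < m)%N -> v k x = 0) -> f x = 0) ->
  exists c : nat -> K, forall x, F x -> f x = \sum_(k < m) c k * v k x.
Proof.
move=> lv; elim: m F f => [|m IH] F f lf [F0 FL] hf.
  by exists (fun=> 0) => x Fx; rewrite big_ord0 hf.
pose F1 := F `&` [set x | v m x = 0].
have [|x [Fx vx] hx|c cP] := IH F1 f lf.
- split; first by split => //=; exact: lin_0.
  move=> a x y [Fx /= vx] [Fy /= vy]; split; first exact: FL.
  by rewrite /= lv vx vy scaler0 addr0.
- apply: hf => // k; rewrite ltnS leq_eqVlt => /orP[/eqP->//|]; exact: hx.
pose h x : K^o := f x - \sum_(k < m) c k * v k x.
have hF1 x : F x -> v m x = 0 -> h x = 0.
  by move=> Fx vx; rewrite /h cP ?subrr.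
have hL x y a : h (x - a *: y) = h x - a * h y.
  rewrite /h (lin_B lf) (lin_Z lf) -[a *: f y]/(a * f y).
  have -> : \sum_(k < m) c k * v k (x - a *: y) =
      \sum_(k < m) c k * v k x - a * \sum_(k < m) c k * v k y.
    rewrite mulr_sumr -sumrB; apply: eq_bigr => k _.
    by rewrite (lin_B (lv k)) (lin_Z (lv k)) -[a *: _]/(a * _); ring.
  by ring.
have [[x1 [Fx1 vx1]]|nx1] := pselect (exists x1, F x1 /\ v m x1 <> 0).
  exists (fun k => if k == m then h x1 / v m x1 else c k) => x Fx.
  rewrite big_ord_recr /= eqxx.
  have -> : \sum_(k < m) (if k == m :> nat then h x1 / v m x1 else c k) * v k x
     = \sum_(k < m) c k * v k x.
    by apply: eq_bigr => k _; rewrite ltn_eqF.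
  apply/eqP; rewrite addrC -subr_eq -/(h x) -subr_eq0; apply/eqP.
  have := hF1 (x - (v m x / v m x1) *: x1); rewrite hL.
  have Fd : F (x - (v m x / v m x1) *: x1).
    by rewrite addrC -scaleNr; exact: FL.
  move=> /(_ Fd); rewrite (lin_B (lv m)) (lin_Z (lv m)) -[_ *: _]/(_ * _).
  move/eqP in vx1; rewrite divfK// subrr => /(_ erefl) <-.
  by ring.
exists c => x Fx; have vx : v m x = 0.
  by apply: contrapT => vx; apply: nx1; exists x.
by rewrite big_ord_recr /= vx mulr0 addr0 cP.
Qed.

Section SeparableSubspaces.
Variables (R : realType) (K : numFieldType) (S : scalars R K).
Local Notation emb := (emb S).
Local Notation re := (re S).
Local Notation iu := (iu S).
Local Notation rn x := (re `|x|).

Definition rat_scalar (q : rat * rat) : K :=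
  emb (ratr q.1) - iu * emb (ratr q.2).

Lemma rat_scalar_dense (c : K) (e : R) : 0 < e ->
  exists q, rn (c - rat_scalar q) < e.
Proof.
move=> e0; have e2 : 0 < e / 2 by rewrite divr_gt0.
have approx a : exists q, `|a - ratr q| < e / 2.
  have [|q] := @rat_in_itvoo R (a - e / 2) a; first by lra.
  by rewrite in_itv/= => /andP[h1 h2]; exists q; rewrite ltr_distl; lra.
have [p hp] := approx (re c); have [q hq] := approx (re (iu * c)).
exists (p, q); rewrite /rat_scalar /=.
have -> : c - (emb (ratr p) - iu * emb (ratr q)) =
    emb (re c - ratr p) - iu * emb (re (iu * c) - ratr q).
  by rewrite {1}(scalar_split S c) !rmorphB /=; ring.
rewrite (le_lt_trans (rnD S _ _))// (rnN S) rnM !rn_emb.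
have := ler_piMl (normr_ge0 (re (iu * c) - ratr q)) (rn_iu S); lra.
Qed.

Variables (X : normedModType K) (Y : submodClosed X).
Let N := @subspace_norm K X Y.

Let N_ge0 y : 0 <= N y. Proof. exact: normr_ge0. Qed.
Let N_Z a y : N (a *: y) = `|a| * N y. Proof. exact: normrZ. Qed.

Lemma enumerate_separable : separable_for N ->
  exists d : nat -> X, forall x (e : R), x \in Y -> 0 < e ->
    exists k, rn (x - d k) < e.
Proof.
move=> [D /countable_injP[f finj] Ddense].
exists (fun n => val (xget 0 [set z | D z /\ f z = n])) => x e Yx e0.
have [|z Dz Nz] := Ddense (Sub x Yx) (emb e).
  by rewrite -(rmorph0 emb) emb_lt.
exists (f z); case: xgetP => [w _ [Dw fw]|/(_ z)[]//].
rewrite (finj w z) ?inE// rn_lt.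
by move: Nz; rewrite /N /subspace_norm raddfB.
Qed.

(** Support functionals at the points of a dense sequence of Y. *)
Lemma norming_sequence : separable_for N -> exists v : nat -> dual X,
  (forall k x, rn (v k x) <= rn x) /\
  forall x (e : R), x \in Y -> 0 < e -> exists k, rn x - e <= rn (v k x).
Proof.
move=> /enumerate_separable[d dP].
have [v vP] := choice (fun k => support_functional S (d k)).
exists v; split=> [k x|x e Yx e0]; first by have [] := vP k.
have [k hk] := dP x (e / 2) Yx ltac:(by rewrite divr_gt0).
exists k; have [vk vdk] := vP k.
have h1 : rn (v k (d k)) = rn (d k) by rewrite vdk normr_id.
have h2 := vk (x - d k).
have h3 := rnD S (v k x) (- v k (x - d k)).
have h4 := rnD S (d k) (x - d k).
move: h3 h4; rewrite (rnN S) addrCA subrr addr0.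
have -> : v k x - v k (x - d k) = v k (d k).
  by rewrite bop_addr bop_oppr opprD opprK addrA subrr add0r.
rewrite h1; lra.
Qed.

(** Otherwise every functional g on Y is small on a finite intersection F of
    kernels of the v k. A small Hahn-Banach extension h of g from F then differs
    from g, on Y, by a combination of finitely many v k, and the combinations with
    rational coefficients would be dense in the dual of Y. *)
Lemma nonseparable_dual (v : nat -> dual X) :
  (forall k x, rn (v k x) <= rn x) ->
  ~ separable_for (@opnorm K (Defs.subspace Y) N K^o) ->
  exists (g : X -> K^o) (c e : R), [/\ linear g, 0 < e,
    forall x, rn (g x) <= c * rn x &
    forall m, exists x, [/\ x \in Y, rn x <= 1,
      forall k, (k < m)%N -> v k x = 0 & e <= rn (g x)]].
Proof.
move=> v1 nsep; apply: contrapT => hno; apply: nsep.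
have lv k : linear (v k : X -> K^o) by exact: bop_linear.
have hw k : (fun y => v k (val y) : K^o) \in
    @bounded_linear K (Defs.subspace Y) N K^o.
  apply: (@bounded_linearP _ _ S _ N K^o N_ge0 _ 1) => [a x y|y].
    exact: lv.
  by rewrite mul1r; exact: v1.
pose w k : boundedOp N K^o := BoundedOp (hw k).
pose comb (s : seq (rat * rat)) : boundedOp N K^o :=
  \sum_(i < size s) rat_scalar (nth (0, 0) s i) *: w i.
have combE s y : comb s y =
    \sum_(i < size s) rat_scalar (nth (0, 0) s i) * v i (val y).
  exact: (big_morph (fun f : boundedOp N K^o => f y) (fun _ _ => erefl) erefl).
exists (range comb).
  exact: sub_countable (card_image_le _ _) (countableP _).
move=> z eps eps0; pose e := re eps.
have e0 : 0 < e by rewrite -(emb_lt S) rmorph0 emb_re// ltW.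
have [c c0 zc] := bop_bounded S N_ge0 z.
pose pr (x : X) : Defs.subspace Y := insubd 0 x.
have prE x : x \in Y -> val (pr x) = x by move=> Yx; rewrite val_insubd Yx.
have YL : linear_subspace [set x : X | x \in Y].
  split; first exact: rpred0.
  by move=> a x y /= Yx Yy; rewrite rpredD// rpredZ.
have e4 : 0 < e / 4 by rewrite divr_gt0.
(* z is first extended to X, so that everything takes place in X. *)
have [|||||g [lg gz gc]] := @hahn_banach _ _ S X (fun x => c * rn x)
  [set x | x \in Y] (fun x => z (pr x)).
- by move=> x y; rewrite -mulrDr ler_wpM2l// rnD.
- by move=> a x; rewrite rnZ mulrCA.
- exact: YL.
- move=> a x y Yx Yy; rewrite -bop_scaler -bop_addr; congr (z _).
  by apply: val_inj; rewrite /= !prE//; apply: YL.2.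
- by move=> x Yx; rewrite (le_trans (zc _))// /N /subspace_norm prE.
have [m hm] : exists m, forall x, x \in Y -> rn x <= 1 ->
    (forall k, (k < m)%N -> v k x = 0) -> rn (g x) < e / 4.
  apply: contrapT => nm; apply: hno; exists g, c, (e / 4); split=> // m.
  apply: contrapT => nx; apply: nm; exists m => x Yx x1 vx.
  by rewrite ltNge; apply/negP => gx; apply: nx; exists x.
pose F := [set x : X | x \in Y /\ forall k, (k < m)%N -> v k x = 0].
have [|||||h [lh hg hc]] := @hahn_banach _ _ S X (fun x => e / 4 * rn x) F g.
- by move=> x y; rewrite -mulrDr ler_wpM2l ?rnD ?(ltW e4).
- by move=> a x; rewrite rnZ mulrCA.
- split; first by split=> [|k _]; [exact: rpred0|exact: lin_0 (lv k)].
  move=> a x y [Yx vx] [Yy vy]; split; first exact: YL.2.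
  by move=> k km; rewrite lv vx// vy// scaler0 addr0.
- by move=> a x y _ _; exact: lg.
- move=> x [Yx vx]; have [->|x0] := eqVneq x 0.
    by rewrite (lin_0 lg) !(rn0 S) mulr0.
  have nx : 0 < rn x by rewrite lt_def rn_eq0 x0 rn_ge0.
  have ix : 0 <= (rn x)^-1 by rewrite invr_ge0 ltW.
  have := hm (emb (rn x)^-1 *: x) (rpredZ _ Yx).
  rewrite (rnZ S) rn_emb (ger0_norm ix) mulVf ?gt_eqF// => /(_ (lexx _)).
  rewrite (lin_Z lg) (rnZ S) rn_emb (ger0_norm ix) ltr_pdivrMl// mulrC.
  move=> /(_ _)/ltW; apply => k km.
  by rewrite (lin_Z (lv k)) vx// scaler0.
have [||||b bP] := @span_of_kernels K X v m [set x | x \in Y]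
  (fun x => g x - h x).
- exact: lv.
- by move=> a x y; rewrite lg lh scalerBr opprD addrACA.
- exact: YL.
- by move=> x Yx vx; rewrite hg ?subrr.
have m1 : 0 < m.+1%:R :> R by rewrite ltr0n.
have d0 : 0 < e / 4 / m.+1%:R by rewrite divr_gt0.
have [q qP] := choice (fun k => rat_scalar_dense (b k) d0).
exists (comb (mkseq q m)); first by exists (mkseq q m).
rewrite -[eps](emb_re S (ltW eps0)) -(emb_opnorm S N_ge0 N_Z) emb_lt.
apply: (@le_lt_trans _ _ (e / 2)); last by rewrite -/e; lra.
apply: (@opnorm_le _ _ S _ N _ N_ge0 N_Z (z - comb (mkseq q m))) => y Ny.
rewrite bopB combE size_mkseq.
have zg : z y = g (val y).
  rewrite gz; last exact: (valP y).
  by congr (boundedOp_fun z _); apply: val_inj; rewrite prE//; exact: (valP y).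
rewrite zg.
have -> : g (val y) = h (val y) + \sum_(k < m) b k * v k (val y).
  by rewrite -(bP (val y) (valP y)) addrC subrK.
rewrite -addrA -sumrB.
have h1 : rn (h (val y)) <= e / 4.
  by rewrite (le_trans (hc _))// ler_piMr// ltW.
have h2 : rn (\sum_(k < m) (b k * v k (val y) -
    rat_scalar (nth (0, 0) (mkseq q m) k) * v k (val y))) <= e / 4.
  rewrite rn_le (le_trans (ler_norm_sum _ _ _))//.
  apply: (@le_trans _ _ (\sum_(k < m) emb (e / 4 / m.+1%:R))).
    apply: ler_sum => k _; rewrite nth_mkseq// -mulrBl -(rn_le S) rnM.
    rewrite (@le_trans _ _ (rn (b k - rat_scalar (q k)) * 1))//.
      rewrite ler_wpM2l ?rn_ge0// (le_trans (v1 _ _))//.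
    by rewrite mulr1 ltW.
  rewrite sumr_const card_ord -rmorphMn /= emb_le -[_ *+ m]mulr_natr.
  rewrite -mulrA ler_piMr ?(ltW e4)// mulrC ler_pdivrMr// mul1r ler_nat//.
rewrite (le_trans (rnD S _ _))//; lra.
Qed.

End SeparableSubspaces.

Section AlmostNormingSequence.
Variables (R : realType) (K : numFieldType) (S : scalars R K).
Local Notation emb := (emb S).
Local Notation re := (re S).
Local Notation rn x := (re `|x|).
Variables (X : normedModType K) (Y : submodClosed X).
Let N := @subspace_norm K X Y.

(** Let r m be the norm of the functional g of nonseparable_dual on the common
    kernel in Y of the first m functionals v k. This sequence decreases to a
    positive limit, so from some m0 on it is within a factor 1 - eps of r m0. Hence a
    Hahn-Banach extension of g from the m0-th kernel, divided by r m0, is almost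
    normed at points of all later kernels. The last property holds because v k
    vanishes at y m for m > k and the v k norm Y. *)
Lemma almost_norming_sequence (eps : R) : 0 < eps -> eps < 1 ->
  separable_for N -> ~ separable_for (@opnorm K (Defs.subspace Y) N K^o) ->
  exists (y : nat -> X) (f : X -> K^o) (a : nat -> R),
  [/\ linear f, forall x, rn (f x) <= rn x,
      forall m,
        [/\ y m \in Y, rn (y m) <= 1, f (y m) = emb (a m) & 1 - eps <= a m] &
      forall x k e, x \in Y -> 0 < e ->
        exists m0, forall m, (m0 <= m)%N -> rn x - e <= rn (x + k *: y m)].
Proof.
move=> eps0 eps1 sep nsep.
have [v [v1 vN]] := norming_sequence S sep.
have [g [c [e [lg e0 gc gP]]]] := nonseparable_dual v1 nsep.
pose A m := [set rn (g x) | x in [set x : X | [/\ x \in Y, rn x <= 1 &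
  forall k, (k < m)%N -> v k x = 0]]].
pose r m := sup (A m).
have Asup m : has_sup (A m).
  split; first by have [x [Yx x1 vx gx]] := gP m; exists (rn (g x)), x.
  exists `|c| => _ [x [_ x1 _] <-]; rewrite (le_trans (gc x))//.
  rewrite (le_trans (ler_norm _))// normrM ler_piMr//.
  by rewrite ger0_norm ?rn_ge0.
have r_ge m x : x \in Y -> rn x <= 1 -> (forall k, (k < m)%N -> v k x = 0) ->
    rn (g x) <= r m.
  by move=> Yx x1 vx; apply: ub_le_sup; [case: (Asup m)|exists x].
have e_le m : e <= r m.
  by have [x [Yx x1 vx /le_trans]] := gP m; apply; exact: r_ge.
have rinf : has_inf (range r).
  by split; [exists (r 0%N), 0%N|exists e => _ [m _ <-]].
have d0 : 0 < inf (range r).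
  by apply: lt_le_trans e0 _; apply: lb_le_inf; [case: rinf|move=> _ [m _ <-]].
set d := inf _ in d0.
have d_le m : d <= r m by apply: ge_inf; [case: rinf|exists m].
have [m0 rm0] : exists m0, r m0 * (1 - eps) < d.
  have e10 : 0 < 1 - eps by rewrite subr_gt0.
  have [|_ [m0 _ <-] h] := @inf_adherent R (range r) (d / (1 - eps) - d) _ rinf.
    rewrite subr_gt0 ltr_pdivlMr// -[X in _ < X]mulr1 ltr_pM2l//; lra.
  by exists m0; move: h; rewrite -/d addrC subrK ltr_pdivlMr.
have r0 : 0 < r m0 by apply: lt_le_trans (d_le _).
pose F := [set x : X | x \in Y /\ forall k, (k < m0)%N -> v k x = 0].
have lv k : linear (v k : X -> K^o) by exact: bop_linear.
have [|||||h [lh hg hc]] := @hahn_banach _ _ S X (fun x => r m0 * rn x) F g.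
- by move=> x y; rewrite -mulrDr ler_wpM2l ?rnD ?(ltW r0).
- by move=> b x; rewrite rnZ mulrCA.
- split; first by split=> [|k _]; [exact: rpred0|exact: lin_0 (lv k)].
  move=> b x y [Yx vx] [Yy vy]; split; first by rewrite rpredD// rpredZ.
  by move=> k km; rewrite lv vx// vy// scaler0 addr0.
- by move=> b x y _ _; exact: lg.
- move=> x [Yx vx]; have [->|x0] := eqVneq x 0.
    by rewrite (lin_0 lg) !(rn0 S) mulr0.
  have nx : 0 < rn x by rewrite lt_def rn_eq0 x0 rn_ge0.
  have ix : 0 <= (rn x)^-1 by rewrite invr_ge0 ltW.
  have := r_ge m0 (emb (rn x)^-1 *: x) (rpredZ _ Yx).
  rewrite (rnZ S) rn_emb (ger0_norm ix) mulVf ?gt_eqF// => /(_ (lexx _)).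
  rewrite (lin_Z lg) (rnZ S) rn_emb (ger0_norm ix) ler_pdivrMl// mulrC.
  by apply => k km; rewrite (lin_Z (lv k)) vx// scaler0.
have ex m : exists x, [/\ x \in Y, rn x <= 1,
    forall k, (k < maxn m0 m)%N -> v k x = 0
    & exists2 b, g x = emb b & (1 - eps) * r m0 <= b].
  have [|_ [x [Yx x1 vx] <-] hx] := @sup_adherent R (A (maxn m0 m))
      (r (maxn m0 m) - (1 - eps) * r m0) _ (Asup _).
    by rewrite subr_gt0 mulrC (lt_le_trans rm0).
  have [k k1 kE] : exists2 k : K, rn k = 1 & k * g x = `|g x|.
    have [->|z0] := eqVneq (g x) 0.
      by exists 1; rewrite ?rn1// mulr0 normr0.
    exists (`|g x| / g x); last by rewrite divfK.
    by rewrite normrM normfV normr_id divff ?normr_eq0// -(rmorph1 emb) embK.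
  exists (k *: x); split.
  - exact: rpredZ.
  - by rewrite (rnZ S) k1 mul1r.
  - by move=> i im; rewrite (lin_Z (lv i)) vx// scaler0.
  exists (rn (g x)); first by rewrite (lin_Z lg) -[_ *: _]/(_ * _) kE emb_rn.
  by rewrite ltW//; move: hx; rewrite -/(r (maxn m0 m)) opprB addrC subrK.
have [y yP] := choice ex.
have exb m : exists b, g (y m) = emb b /\ (1 - eps) * r m0 <= b.
  by have [_ _ _ [b gb bm]] := yP m; exists b.
have [b bP] := choice exb.
have ri : 0 <= (r m0)^-1 by rewrite invr_ge0 ltW.
exists y, (fun x => emb (r m0)^-1 * h x), (fun m => (r m0)^-1 * b m); split.
- move=> k x z; rewrite lh mulrDr; congr (_ + _).
  by rewrite -[k *: _]/(k * _) -[k *: _]/(k * _); ring.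
- by move=> x; rewrite rnM rn_emb (ger0_norm ri) ler_pdivrMl.
- move=> m; have [Yy y1 vy _] := yP m; have [gb bm] := bP m; split=> //.
    rewrite hg; first by rewrite gb rmorphM.
    by split => // k km; apply: vy; rewrite leq_max km.
  by rewrite ler_pdivlMl// mulrC.
- move=> x k e' Yx e'0; have [m1 hm1] := vN x e' Yx e'0.
  exists m1.+1 => m mm; rewrite (le_trans hm1)//.
  apply: le_trans (v1 m1 (x + k *: y m)).
  have [_ _ vy _] := yP m; rewrite (lin_D (lv m1)) (lin_Z (lv m1)) vy.
    by rewrite scaler0 addr0.
  by rewrite leq_max mm orbT.
Qed.

End AlmostNormingSequence.

(** * M-ideals of compact operators *)

Section MIdealAsplund.
Variables (R : realType) (K : numFieldType) (S : scalars R K).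
Local Notation emb := (emb S).
Local Notation re := (re S).
Local Notation rn x := (re `|x|).
Variable X : normedModType K.

Local Notation functional :=
  (@boundedOp K (operators X) (@numerical_radius K X) K^o).

Let NX_ge0 (x : X) : 0 <= `|x| := normr_ge0 x.

Lemma opnorm_operator_le (T : operators X) c :
  (forall x, rn x <= 1 -> rn (T x) <= c) -> re (opnorm T) <= c.
Proof.
by move=> h; apply: (@opnorm_le _ _ S X (@Num.norm K X) X NX_ge0
  (@normrZ _ _) T).
Qed.

Lemma opnorm_functional_le (h : functional) c :
  (forall T : operators X, re (numerical_radius T) <= 1 -> rn (h T) <= c) ->
  re (opnorm h) <= c.
Proof.
by move=> hc; apply: (@opnorm_le _ _ S _ _ K^o (@radius_ge0 _ _ S X)
  (@radiusZ _ _ S X) h).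
Qed.

Lemma le_opnorm_functional (h : functional) (T : operators X) :
  re (numerical_radius T) <= 1 -> rn (h T) <= re (opnorm h).
Proof.
move=> vT; apply: le_trans (@le_opnorm _ _ S _ _ K^o (@radius_ge0 _ _ S X)
  (@radiusZ _ _ S X) h T) _.
rewrite ler_piMr//; apply: re_ge0.
exact: (@opnorm_ge0 _ _ S _ _ K^o (@radius_ge0 _ _ S X) (@radiusZ _ _ S X) h).
Qed.

Lemma identity_operator : exists I : operators X,
  (forall x, I x = x) /\ re (opnorm I) <= 1.
Proof.
have hI : (fun x : X => x) \in @bounded_linear K X (@Num.norm K X) X.
  by apply: (@bounded_linearP _ _ S X _ X NX_ge0 _ 1) => // x; rewrite mul1r.
exists (BoundedOp hI); split=> //.
exact: opnorm_operator_le.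
Qed.

Lemma rank_one_operator (f : X -> K^o) (v : X) : linear f ->
  (forall x, rn (f x) <= rn x) -> rn v <= 1 ->
  exists T : operators X, [/\ forall x, T x = f x *: v, re (opnorm T) <= 1 &
    compact_operators T].
Proof.
move=> lf f1 v1.
have hT : (fun x : X => f x *: v) \in @bounded_linear K X (@Num.norm K X) X.
  apply: (@bounded_linearP _ _ S X _ X NX_ge0 _ 1) => // [a x y|x].
    by rewrite lf scalerDl scalerA.
  by rewrite (rnZ S) mul1r (le_trans _ (f1 x))// ler_piMr// rn_ge0.
exists (BoundedOp hT); split=> //.
  apply: opnorm_operator_le => x x1.
  by rewrite /= (rnZ S) mulr_ile1 ?rn_ge0// (le_trans (f1 x)).
apply: (@rank_one_precompact R K S X f 1) => x.
by rewrite -(rmorph1 emb) -rn_le => /(le_trans (f1 x)).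
Qed.

(** In the bidual, an ultrafilter limit y of the y_m would be orthogonal to Y and
    phi would be a functional on it vanishing at y, with psi(T) = phi(T y);
    the seminorm p on pairs (x, T) plays the role of the norm of x + T y and
    avoids biduals altogether. *)
Lemma separating_functionals (n : R) (Y : submodClosed X) (t : R) :
  (forall T : operators X, n * re (opnorm T) <= re (numerical_radius T)) ->
  separable_for (@subspace_norm K X Y) ->
  ~ separable_for (@opnorm K (Defs.subspace Y) (@subspace_norm K X Y) K^o) ->
  2^-1 < n -> 0 < t -> t <= 2^-1 ->
  exists psi psi0 : functional, exists I T : operators X,
  [/\ re (opnorm psi) <= n^-1, re (opnorm psi0) <= 1 + 12 * t,
      forall T, compact_operators T -> psi T = psi0 T,
      [/\ re (numerical_radius I) <= 1, psi I = 0 & 1 - t ^+ 2 <= rn (psi0 I)] &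
      [/\ re (numerical_radius T) <= 1, compact_operators T &
          (1 - t ^+ 2) ^+ 2 <= rn (psi0 T)]].
Proof.
move=> nT sep nsep n2 t0 t2.
have n0 : 0 < n by rewrite (lt_trans _ n2)// invr_gt0.
have eps0 : 0 < t ^+ 2 by rewrite exprn_gt0.
have eps1 : t ^+ 2 < 1 by rewrite expr2; nra.
have [y [f [a [lf f1 yP dist]]]] :=
  almost_norming_sequence S eps0 eps1 sep nsep.
have y1 m : rn (y m) <= 1 by have [] := yP m.
have [U [ultraU subU]] := @ultraFilterLemma _ (\oo)%classic _.
have opT T z : rn z <= 1 -> rn ((T : operators X) z) <= re (opnorm T).
  move=> z1; rewrite (le_trans (le_norm_op S T z))// ler_piMr//.
  exact/re_ge0/(opnorm_ge0 S)/normrZ.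
have [I [IE I1]] := identity_operator.
pose W : lmodType K := (X * operators X)%type.
pose q (w : W) (m : nat) : K^o := `|w.1 + w.2 (y m)|.
have qP w : ucvg S U (q w) (ulim S U (q w)).
  apply: (@ulimP _ _ S U ultraU _ (rn w.1 + re (opnorm w.2))) => m.
  by rewrite normr_id (le_trans (rnD S _ _))// lerD2l opT.
pose p w := re (ulim S U (q w)).
have p_sub w z : p (w + z) <= p w + p z.
  rewrite /p -raddfD.
  apply: (ucvg_re_le ultraU (qP _) (ucvgD ultraU (qP w) (qP z))).
  apply: (filterS _ filterT) => m _ /=; rewrite raddfD /q /=.
  by rewrite addrACA; exact: rnD.
have p_hom b w : p (b *: w) = rn b * p w.
  have : ucvg S U (q (b *: w)) (`|b| *: (ulim S U (q w) : K^o)).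
    rewrite (_ : q (b *: w) = fun m => `|b| *: q w m).
      exact: ucvgZ (qP w).
    by apply: funext => m; rewrite /q /= -scalerDr normrZ.
  move=> /(ulimE ultraU); rewrite /p => ->.
  by rewrite -[_ *: _]/(_ * _) re_normM.
have p_ge w c : U [set m | c <= re (q w m)] -> c <= p w.
  move=> h; rewrite -[c](embK S).
  apply: (ucvg_re_le ultraU (ucvg_cst S ultraU _) (qP w)).
  by apply: (filterS _ h) => m /=; rewrite embK.
have p_le w c : (forall m, re (q w m) <= c) -> p w <= c.
  move=> h; rewrite -[c](embK S).
  apply: (ucvg_re_le ultraU (qP w) (ucvg_cst S ultraU _)).
  by apply: (filterS _ filterT) => m _ /=; rewrite embK.
pose F : set W := [set w | w.1 \in Y /\ exists k : K, w.2 = k *: I].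
have [|||||phi [lphi phiF phi_p]] := @hahn_banach _ _ S W p F (fun w => f w.1).
- exact: p_sub.
- exact: p_hom.
- split; first by split; [exact: rpred0|exists 0; rewrite scale0r].
  move=> b w z [/= Yw [k wk]] [/= Yz [l zl]]; split.
    by rewrite rpredD// rpredZ.
  by exists (b * k + l); rewrite /= wk zl scalerA scalerDl.
- by move=> b w z _ _; exact: lf.
- move=> w [/= Yw [k wk]]; apply/ler_addgt0Pl => e e0.
  rewrite -lerBlDl (le_trans (lerB (f1 _) (lexx e)))//; apply: p_ge.
  have [m0 hm] := dist w.1 k e Yw e0.
  apply: subU; exists m0 => // m /= mm.
  by rewrite /q wk bopZ IE; exact: hm.
pose x0 (x : X) : K^o := phi ((x, 0) : W).
have lx0 : linear x0.
  move=> b u v; rewrite /x0 -lphi; congr phi.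
  by rewrite -[RHS]/(b *: u + v, b *: 0 + 0) scaler0 addr0.
have x01 x : rn (x0 x) <= rn x.
  by rewrite (le_trans (phi_p _))//; apply: p_le => m; rewrite /q /= addr0.
have x0Y m : x0 (y m) = emb (a m).
  have [Yy _ <- _] := yP m; apply: phiF; split=> //=.
  by exists 0; rewrite scale0r.
have vT (T : operators X) : re (opnorm T) <= n^-1 * re (numerical_radius T).
  by rewrite ler_pdivlMl.
pose psif (T : operators X) : K^o := phi ((0, T) : W).
have psi_op T : rn (psif T) <= re (opnorm T).
  rewrite (le_trans (phi_p _))//; apply: p_le => m.
  by rewrite /q /= add0r opT.
have hpsi : psif \in
    @bounded_linear K (operators X) (@numerical_radius K X) K^o.
  apply: (@bounded_linearP _ _ S _ _ K^o _ _ n^-1) => [T||T].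
  - exact: (radius_ge0 S).
  - move=> b T T'; rewrite /psif -lphi; congr phi.
    by rewrite -[RHS]/(b *: 0 + 0, b *: T + T') scaler0 addr0.
  - exact: le_trans (psi_op T) (vT T).
pose psi0f (T : operators X) : K^o := ulim S U (fun m => x0 (T (y m))).
have psi0P T : ucvg S U (fun m => x0 ((T : operators X) (y m))) (psi0f T).
  apply: (@ulimP _ _ S U ultraU _ (re (opnorm T))) => m.
  by rewrite (le_trans (x01 _)) ?opT.
have hpsi0 : psi0f \in
    @bounded_linear K (operators X) (@numerical_radius K X) K^o.
  apply: (@bounded_linearP _ _ S _ _ K^o _ _ n^-1) => [T||T].
  - exact: (radius_ge0 S).
  - move=> b T T'; apply: (ulimE ultraU).
    rewrite (_ : (fun m => _) = fun m => b *: x0 (T (y m)) + x0 (T' (y m))).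
      exact: (ucvgD ultraU (ucvgZ ultraU b (psi0P T)) (psi0P T')).
    by apply: funext => m; rewrite bopD bopZ lx0.
  - apply: le_trans (vT T); apply: (ucvg_norm_le ultraU (psi0P T)).
    by apply: (filterS _ filterT) => m _ /=; rewrite (le_trans (x01 _)) ?opT.
have [T0 [T0E T01 T0c]] := rank_one_operator lx0 x01 (y1 0%N).
have psi0I : 1 - t ^+ 2 <= re (psi0f I).
  rewrite -[X in X <= _](embK S).
  apply: (ucvg_re_le ultraU (ucvg_cst S ultraU _) (psi0P I)).
  apply: (filterS _ filterT) => m _ /=; rewrite IE x0Y !embK.
  by have [] := yP m.
exists (BoundedOp hpsi), (BoundedOp hpsi0), I, T0; split.
- apply: opnorm_functional_le => T T1.
  rewrite (le_trans (psi_op T))// (le_trans (vT T))// ler_piMr// invr_ge0 ltW//.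
- apply: opnorm_functional_le => T T1.
  apply: (ucvg_norm_le ultraU (psi0P T)).
  apply: (filterS _ filterT) => m _ /=.
  have [_ _ _ am] := yP m.
  apply: (almost_norming_pair lx0 x01 (y1 m) (x0Y m) t0 t2 am T1).
  rewrite (le_trans (vT T))// (@le_trans _ _ n^-1)//.
    by rewrite ler_piMr// invr_ge0 ltW.
  by rewrite -[2]invrK lef_pV2 ?posrE ?invr_gt0// ltW.
- (* T y_m tends to some z along U, and then p (- z, T) = 0. *)
  move=> T Tc /=.
  pose B := T @` [set x : X | `|x| <= 1].
  have cB : compact (closure B) by rewrite -precompactE.
  have Ty m : closure B (T (y m)).
    apply: subset_closure; exists (y m) => //=.
    by rewrite -(rmorph1 emb) -rn_le.
  have [z _ yz] := ucvg_compact S ultraU cB Ty.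
  have -> : psi0f T = x0 z.
    apply: (ulimE ultraU) => e e0; apply: (filterS _ (yz e e0)) => m /=.
    by apply: le_lt_trans; rewrite -(lin_B lx0).
  apply/eqP; rewrite -subr_eq0 -(rn_eq0 S) eq_le rn_ge0 andbT.
  have -> : psif T - x0 z = phi ((- z, T) : W).
    rewrite /psif /x0 -(lin_B lphi); congr phi.
    by rewrite -[LHS]/(0 - z, T - 0) subr0 add0r.
  rewrite (le_trans (phi_p _))// -(raddf0 re) /p.
  apply/ler_addgt0Pl => e e0; rewrite raddf0 addr0 -[e](embK S).
  apply: (ucvg_re_le ultraU (qP _) (ucvg_cst S ultraU (emb e))).
  apply: (filterS _ (yz e e0)) => m /=.
  by rewrite embK /q /= addrC => /ltW.
- split; first exact: le_trans (radius_le_opnorm S I) I1.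
    rewrite /= /psif phiF; first exact: lin_0 lf.
    by split; [exact: rpred0|exists 1; rewrite scale1r].
  exact: le_trans psi0I (re_le_norm S _).
- split=> //; first exact: le_trans (radius_le_opnorm S T0) T01.
  have -> : BoundedOp hpsi0 T0 = psi0f I * emb (a 0%N).
    rewrite /=; apply: (ulimE ultraU).
    rewrite (_ : (fun m => _) =
      fun m => (emb (a 0%N) : K) *: x0 (I (y m))); last first.
      apply: funext => m; rewrite T0E (lin_Z lx0) IE !x0Y.
      by rewrite -[LHS]/(_ * _) mulrC.
    by rewrite mulrC; exact: ucvgZ (psi0P I).
  have [_ _ _ a0] := yP 0%N.
  have e10 : 0 <= 1 - t ^+ 2 by rewrite subr_ge0 ltW.
  rewrite rnM rn_emb expr2 ler_pM//.
    exact: le_trans psi0I (re_le_norm S _).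
  by rewrite (le_trans a0) ?ler_norm.
Qed.

(** The quantities to compare are, up to O(t): the norm of P psi0 is 1, that of
    psi0 - P psi0 is 0 and that of psi - P psi is 1, while the sum of the first and
    the last one is at most 1 / n < 2. *)
Theorem M_ideal_asplund : 2%:R^-1 < numerical_index X ->
  M_ideal (@numerical_radius K X) (@compact_operators K X) -> asplund X.
Proof.
move=> /(index_gt_half S)[n n2 nT] [_ _ [P [PP kerP normP]]] Y sep.
apply: contrapT => nsep.
have n0 : 0 < n by rewrite (lt_trans _ n2)// invr_gt0.
have ni2 : n^-1 < 2 by rewrite -[2]invrK ltf_pV2 ?posrE ?invr_gt0.
have ni0 : 0 < n^-1 by rewrite invr_gt0.
(* The errors below add up to at most 15 t. *)
pose t := (2 - n^-1) / 16.
have t0 : 0 < t by rewrite /t; lra.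
have t2 : t <= 2^-1 by rewrite /t; lra.
have [psi [psi0 [I [T [psi_le psi0_le agree hI hT]]]]] :=
  separating_functionals nT sep nsep n2 t0 t2.
have [[vI psiI psi0I] [vT cT psi0T]] := (hI, hT).
have Peq : P psi = P psi0.
  apply/eqP; rewrite -subr_eq0 -raddfB; apply/eqP.
  suff : [set h | P h = 0] (psi - psi0) by [].
  by rewrite kerP => A cA; rewrite bopB agree// subrr.
have P0T : P psi0 T = psi0 T.
  have : [set h | P h = 0] (psi0 - P psi0).
    rewrite /= (raddfB P); apply/eqP; rewrite subr_eq0; apply/eqP.
    exact: esym (PP psi0).
  rewrite kerP => /(_ T cT); rewrite bopB => /eqP; rewrite subr_eq0.
  by move=> /eqP.
have h1 : re (opnorm psi0) = re (opnorm (P psi0)) + re (opnorm (psi0 - P psi0)).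
  by rewrite -(raddfD re) -normP.
have h2 : re (opnorm psi) = re (opnorm (P psi0)) + re (opnorm (psi - P psi0)).
  by rewrite -(raddfD re) -Peq -normP.
have h3 := le_opnorm_functional (P psi0) vT; rewrite P0T in h3.
have h4 := le_opnorm_functional (psi0 - P psi0) vI.
have h5 := le_opnorm_functional (psi - P psi0) vI.
rewrite bopB psiI sub0r (rnN S) in h5.
have h6 := rnD S ((psi0 - P psi0) I) (P psi0 I).
rewrite bopB subrK in h6; rewrite bopB in h4.
have h7 : t ^+ 2 <= t / 2 by rewrite expr2; nra.
have h8 : t = (2 - n^-1) / 16 by [].
have h9 : 1 - 2 * t ^+ 2 <= (1 - t ^+ 2) ^+ 2 by rewrite !expr2; nra.
lra.
Qed.

End MIdealAsplund.

(** * Spaces containing l_1 *)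

Section Ell1NotAsplund.
Variables (R : realType) (K : numFieldType) (S : scalars R K).
Local Notation emb := (emb S).
Local Notation re := (re S).
Local Notation rn x := (re `|x|).

Definition abs_sum (a : nat -> K) (n : nat) : R := \sum_(k < n) rn (a k).

Lemma abs_sumD a m n :
  abs_sum a (m + n) = abs_sum a m + \sum_(k < n) rn (a (m + k)%N).
Proof. by rewrite /abs_sum big_split_ord. Qed.

Lemma abs_sum_le a m n : (m <= n)%N -> abs_sum a m <= abs_sum a n.
Proof.
by move=> /subnKC <-; rewrite abs_sumD lerDl sumr_ge0// => k _; exact: rn_ge0.
Qed.

Lemma abs_sum_ge0 a n : 0 <= abs_sum a n.
Proof. by rewrite sumr_ge0// => k _; exact: rn_ge0. Qed.

Lemma emb_abs_sum a n : emb (abs_sum a n) = \sum_(k < n) `|a k|.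
Proof. by rewrite rmorph_sum; apply: eq_bigr => k _; rewrite emb_rn. Qed.

Lemma summable_seqP (a : nat -> K^o) c : (forall n, abs_sum a n <= c) ->
  a \in @summable_seq K.
Proof.
by move=> h; apply/asboolP; exists (emb c) => n; rewrite -emb_abs_sum emb_le.
Qed.

Lemma has_sup_abs_sum (a : ell1 K) : has_sup (range (abs_sum a)).
Proof.
split; first by exists (abs_sum a 0), 0%N.
have /asboolP[M aM] := ell1P a; exists (re M) => _ [n _ <-].
rewrite -[abs_sum a n](embK S) emb_abs_sum; apply: emb_re_le => //.
by rewrite sumr_ge0.
Qed.

(** The limit which defines the norm is taken in K, where there is no monotone
    convergence theorem: it is transported from R. *)
Lemma ell1_normE (a : ell1 K) : ell1_norm a = emb (sup (range (abs_sum a))).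
Proof.
set s := sup _; apply: cvg_lim; first exact: norm_hausdorff.
apply/cvgrPdist_lt => e e0.
have re0 : 0 < re e by rewrite -(emb_lt S) rmorph0 emb_re// ltW.
have [_ [m _ <-] hm] := sup_adherent re0 (has_sup_abs_sum a).
exists m => // n /= mn; rewrite /series /= big_mkord -emb_abs_sum -rmorphB.
rewrite norm_emb -[e](emb_re S (ltW e0)) emb_lt.
have h : abs_sum a n <= s.
  by apply: ub_le_sup; [case: (has_sup_abs_sum a)|exists n].
rewrite ger0_norm ?subr_ge0//; have := abs_sum_le a mn; move: hm.
rewrite -/s; lra.
Qed.

Lemma abs_sum_le_ell1_norm (a : ell1 K) n : abs_sum a n <= re (ell1_norm a).
Proof.
rewrite ell1_normE embK; apply: ub_le_sup; last by exists n.
by case: (has_sup_abs_sum a).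
Qed.

Lemma ell1_norm_le (a : ell1 K) c : (forall n, abs_sum a n <= c) ->
  re (ell1_norm a) <= c.
Proof.
move=> h; rewrite ell1_normE embK; apply: ge_sup; last by move=> _ [n _ <-].
by case: (has_sup_abs_sum a).
Qed.

Lemma ell1_tail (a : ell1 K) e : 0 < e ->
  exists m, forall n, \sum_(k < n) rn (a (m + k)%N) <= e.
Proof.
move=> e0; have [_ [m _ <-] hm] := sup_adherent e0 (has_sup_abs_sum a).
exists m => n; have := abs_sumD a m n; have := abs_sum_le_ell1_norm a (m + n).
rewrite ell1_normE embK; lra.
Qed.

Lemma finite_seq_summable (s : seq K) :
  (nth 0 s : nat -> K^o) \in @summable_seq K.
Proof.
apply: (@summable_seqP _ (abs_sum (nth 0 s) (size s))) => n.
apply: le_trans (abs_sum_le _ (leq_maxr (size s) n)) _.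
rewrite maxnE abs_sumD -[leRHS]addr0 lerD2l big1// => k _.
by rewrite nth_default ?leq_addr// (rn0 S).
Qed.

Definition finite_seq (s : seq K) : ell1 K := Ell1 (finite_seq_summable s).

Variables (X : normedModType K) (J : {linear ell1 K -> X}).

Definition ell1_image : {pred X} := fun x => `[<exists a, J a = x>].

Lemma ell1_image_submod : submod_closed ell1_image.
Proof.
split=> [|k x y /asboolP[a <-] /asboolP[b <-]]; apply/asboolP.
  by exists 0; rewrite linear0.
by exists (k *: a + b); rewrite linearP.
Qed.

HB.instance Definition _ :=
  GRing.isSubmodClosed.Build K X ell1_image ell1_image_submod.

Let Y : submodClosed X := ell1_image.
Let N := @subspace_norm K X Y.

Variables (c C : R).
Hypothesis c_gt0 : 0 < c.
Hypothesis J_ge : forall a, c * re (ell1_norm a) <= rn (J a).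
Hypothesis J_le : forall a, rn (J a) <= C * re (ell1_norm a).

Let mem_image a : J a \in Y. Proof. by apply/asboolP; exists a. Qed.

(** Finite sequences with rational entries are dense. *)
Lemma ell1_image_separable : separable_for N.
Proof.
pose q s : Defs.subspace Y :=
  Sub (J (finite_seq [seq rat_scalar S i | i <- s])) (mem_image _).
exists (range q); first exact: sub_countable (card_image_le _ _) (countableP _).
move=> y eps eps0.
have [a ya] : exists a, J a = val y by apply/asboolP/(valP y).
pose e := re eps.
have e0 : 0 < e by rewrite -(emb_lt S) rmorph0 emb_re// ltW.
have C1 : 0 < `|C| + 1 by rewrite ltr_wpDl.
pose d := e / 4 / (`|C| + 1).
have d0 : 0 < d by rewrite !divr_gt0.
have [m am] := ell1_tail a d0.
have m1 : 0 < m.+1%:R :> R by rewrite ltr0n.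
have [r rP] := choice (fun k => rat_scalar_dense S (a k) (divr_gt0 d0 m1)).
exists (q (mkseq r m)); first by exists (mkseq r m).
rewrite -[eps](emb_re S (ltW eps0)) -(rn_lt S) raddfB /= -ya -(raddfB J).
set b := finite_seq _.
have bE k : (a - b) k = a k - b k by [].
have ab n : abs_sum (a - b) n <= 2 * d.
  apply: le_trans (abs_sum_le _ (leq_addl m n)) _.
  rewrite abs_sumD (_ : 2 * d = d + d); last by rewrite mulr_natl.
  apply: lerD.
    apply: (@le_trans _ _ (\sum_(k < m) d / m.+1%:R)).
      apply: ler_sum => k _; rewrite bE /b /= (nth_map (0, 0)) ?size_mkseq//.
      by rewrite nth_mkseq// ltW.
    rewrite sumr_const card_ord -[_ *+ m]mulr_natr -mulrA ler_piMr ?(ltW d0)//.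
    by rewrite mulrC ler_pdivrMr// mul1r ler_nat.
  apply: le_trans (am n); apply: ler_sum => k _.
  by rewrite bE /b /= nth_default ?subr0// size_map size_mkseq leq_addr.
rewrite (le_lt_trans (J_le _))//.
apply: (@le_lt_trans _ _ (`|C| * (2 * d))).
  rewrite (@le_trans _ _ (`|C| * re (ell1_norm (a - b))))//.
    rewrite ler_wpM2r ?ler_norm// (le_trans (abs_sum_ge0 (a - b) 0))//.
    exact: abs_sum_le_ell1_norm.
  by rewrite ler_wpM2l// ell1_norm_le.
have : (`|C| + 1) * d = e / 4 by rewrite /d mulrC divfK// gt_eqF.
rewrite -/e; lra.
Qed.

Lemma ell1_embedding_inj a b : J a = J b -> a = b.
Proof.
move=> ab; have J0 : J (a - b) = 0.
  by rewrite linearB; apply/eqP; rewrite subr_eq0; apply/eqP.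
have := J_ge (a - b); rewrite J0 (rn0 S) pmulr_rle0// => h.
apply: val_inj; apply: funext => k; apply/eqP; rewrite -subr_eq0 -(rn_eq0 S).
rewrite eq_le rn_ge0 andbT; apply: le_trans h.
apply: le_trans (abs_sum_le_ell1_norm (a - b) k.+1).
by rewrite /abs_sum big_ord_recr /= lerDr; exact: abs_sum_ge0.
Qed.

(** The functional phi A sums the entries with index in A; the sum is taken as a
    limit of partial sums along an ultrafilter, which is linear without any
    discussion of convergence. Distinct phi A differ by 1 at some coordinate
    vector, so a countable dense set would inject the sets of indices into the
    natural numbers, against Cantor's diagonal argument. *)
Lemma ell1_image_dual_nonseparable :
  ~ separable_for (@opnorm K (Defs.subspace Y) N K^o).
Proof.
have [U [ultraU subU]] := @ultraFilterLemma _ (\oo)%classic _.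
have preX (y : Defs.subspace Y) : exists a, J a = val y.
  by apply/asboolP/(valP y).
have [pre preE] := choice preX.
have preL k y z : pre (k *: y + z) = k *: pre y + pre z.
  by apply: ell1_embedding_inj; rewrite linearP !preE.
have pre_le y n : abs_sum (pre y) n <= c^-1 * re (N y).
  rewrite (le_trans (abs_sum_le_ell1_norm _ _))// ler_pdivlMl//.
  by rewrite (le_trans (J_ge _))// preE.
pose u (A : nat -> bool) y n : K^o := \sum_(k < n | A k) pre y k.
have u_le A y n : rn (u A y n) <= c^-1 * re (N y).
  apply: le_trans (pre_le y n); rewrite rn_le emb_abs_sum.
  rewrite (le_trans (ler_norm_sum _ _ _))// big_mkcond /=.
  by apply: ler_sum => k _; case: ifP.
have uP A y := ulimP ultraU (u_le A y).
have hphi A : (fun y => ulim S U (u A y) : K^o) \in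
    @bounded_linear K (Defs.subspace Y) N K^o.
  apply: (@bounded_linearP _ _ S _ N K^o _ _ c^-1) => [y|k y z|y].
  - exact: normr_ge0.
  - apply: (ulimE ultraU).
    rewrite (_ : u A _ = fun n => k *: u A y n + u A z n).
      exact: (ucvgD ultraU (ucvgZ ultraU k (uP A y)) (uP A z)).
    apply: funext => n; rewrite /u scaler_sumr -big_split /=.
    by apply: eq_bigr => i _; rewrite preL.
  - apply: (ucvg_norm_le ultraU (uP A y)).
    by apply: (filterS _ filterT) => n _ /=; exact: u_le.
pose phi A : boundedOp N K^o := BoundedOp (hphi A).
have [dl dlE] : exists dl : nat -> ell1 K, forall k i, dl k i = (i == k)%:R.
  exists (fun k => finite_seq (rcons (nseq k 0) 1)) => k i.
  rewrite /= nth_rcons size_nseq; case: ltngtP => // ik.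
  by rewrite nth_nseq ik.
pose y k : Defs.subspace Y := Sub (J (dl k)) (mem_image _).
have pre_y k : pre (y k) = dl k by apply: ell1_embedding_inj; rewrite preE.
have phi_y A k : phi A (y k) = (A k)%:R.
  apply: (ulimE ultraU) => e e0; apply: subU; exists k.+1 => // n /= kn.
  rewrite /u pre_y.
  rewrite (_ : \sum_(i < n | A i) dl k i = (A k)%:R) ?subrr ?(rn0 S)//.
  rewrite big_mkcond (bigD1 (Ordinal kn)) //= dlE eqxx big1 ?addr0; last first.
    move=> i; rewrite -val_eqE /= => ik.
    by rewrite dlE (negPf ik); case: ifP.
  by case: (A k).
move=> [D /countable_injP[code code_inj] Ddense].
have C1 : 0 < `|C| + 1 by rewrite ltr_wpDl.
pose e := (4 * (`|C| + 1))^-1.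
have e0 : 0 < e by rewrite invr_gt0 mulr_gt0.
have ne A : exists d, D d /\ opnorm (phi A - d) < emb e.
  have [|d Dd hd] := Ddense (phi A) (emb e).
    by rewrite -(rmorph0 emb) emb_lt.
  by exists d.
have [d dP] := choice ne.
have N_ge0 z : 0 <= N z := normr_ge0 _.
have N_Z k z : N (k *: z) = `|k| * N z := normrZ _ _.
have Ny k : re (N (y k)) <= `|C| + 1.
  rewrite (le_trans (J_le _))//.
  rewrite (@le_trans _ _ (`|C| * re (ell1_norm (dl k))))//.
    rewrite ler_wpM2r ?ler_norm// (le_trans (abs_sum_ge0 (dl k) 0))//.
    exact: abs_sum_le_ell1_norm.
  have : re (ell1_norm (dl k)) <= 1.
    apply: ell1_norm_le => n.
    apply: le_trans (abs_sum_le _ (leq_maxl n k.+1)) _.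
    have kn : (k < maxn n k.+1)%N by rewrite leq_max ltnSn orbT.
    rewrite /abs_sum (bigD1 (Ordinal kn)) //= dlE eqxx normr1 big1 ?addr0.
      by rewrite -{1}(rmorph1 emb) embK.
    move=> i; rewrite -val_eqE /= => ik.
    by rewrite dlE (negPf ik) (rn0 S).
  have := normr_ge0 C; nra.
have near A k : rn ((phi A - d A) (y k)) <= 4^-1.
  apply: le_trans (@le_opnorm _ _ S _ N K^o N_ge0 N_Z (phi A - d A) (y k)) _.
  have o_le : re (opnorm (phi A - d A)) <= e.
    have [_ /ltW] := dP A.
    rewrite -(emb_opnorm S (F := K^o) N_ge0 N_Z (phi A - d A)).
    by rewrite embK emb_le.
  have o_ge : 0 <= re (opnorm (phi A - d A)).
    exact/re_ge0/(@opnorm_ge0 _ _ S _ N K^o N_ge0 N_Z).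
  have ee : e * (`|C| + 1) = 4^-1 by rewrite /e invfM mulfVK// gt_eqF.
  by rewrite -ee ler_pM// re_ge0.
have d_inj A B : d A = d B -> A = B.
  move=> dAB; apply: funext => k; apply: contrapT => AB.
  have yk : phi A (y k) - phi B (y k) =
      (phi A - d A) (y k) - (phi B - d B) (y k).
    by rewrite !bopB dAB opprB addrA subrK.
  have : rn (phi A (y k) - phi B (y k)) <= 4^-1 + 4^-1.
    rewrite yk (le_trans (rnD S _ _))// (rnN S) lerD//; exact: near.
  have -> : rn (phi A (y k) - phi B (y k)) = 1.
    rewrite !phi_y; move: AB; case: (A k); case: (B k) => //= _.
      by rewrite subr0 rn1.
    by rewrite sub0r (rnN S) rn1.
  lra.
pose g A := code (d A).
have g_inj A B : g A = g B -> A = B.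
  by move=> /code_inj h; apply/d_inj/h; rewrite inE; apply (dP _).1.
pose B n := `[< exists A, g A = n /\ ~~ A n >].
have [BB|nBB] := boolP (B (g B)).
  by have /asboolP[A [/g_inj AB]] := BB; rewrite AB BB.
by move: (nBB) => /asboolPn; apply; exists B.
Qed.

Lemma ell1_image_not_asplund : ~ asplund X.
Proof.
move=> aX; apply: ell1_image_dual_nonseparable.
exact/aX/ell1_image_separable.
Qed.

End Ell1NotAsplund.

Theorem contains_ell1_not_asplund (R : realType) (K : numFieldType)
  (S : scalars R K) (X : normedModType K) : contains_ell1 X -> ~ asplund X.
Proof.
move=> [J [c [C [c0 hJ]]]].
have n0 (a : ell1 K) : 0 <= ell1_norm a.
  have := abs_sum_le_ell1_norm S a 0.
  rewrite (ell1_normE S) embK emb_ge0; exact/le_trans/abs_sum_ge0.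
apply: (@ell1_image_not_asplund R K S X J (re S c) (re S `|C|)).
- by rewrite -(emb_lt S) rmorph0 (emb_re S (ltW c0)).
- move=> a; have /andP[h _] := hJ a.
  rewrite -(re_embM S) (emb_re S (ltW c0)).
  by apply: emb_re_le h; apply: mulr_ge0 => //; exact: ltW.
- move=> a; have /andP[_ h] := hJ a.
  rewrite -(re_normM S); apply: emb_re_le => //.
  have CN : 0 <= C * ell1_norm a by rewrite (le_trans _ h).
  by rewrite (le_trans h)// -(ger0_norm CN) normrM (ger0_norm (n0 a)).
Qed.

Theorem corollary2p9 (R : realType) (K : numFieldType)
    (hK : K = R :> numFieldType \/ K = R[i] :> numFieldType) :
  (forall X : completeNormedModType K,
     2%:R^-1 < numerical_index X ->
     M_ideal (@numerical_radius K X) (@compact_operators K X) ->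
     asplund X) /\
  (forall X : completeNormedModType K,
     contains_ell1 X ->
     2%:R^-1 < numerical_index X ->
     ~ M_ideal (@numerical_radius K X) (@compact_operators K X)).
Proof.
have [S] : inhabited (scalars R K).
  by case: hK => ->; split; [exact: real_scalars|exact: complex_scalars].
split=> [X|X l1X hn hM]; first exact: (M_ideal_asplund S).
exact: contains_ell1_not_asplund S _ l1X (M_ideal_asplund S hn hM).
Qed.
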